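(* Let $n\geqslant 1$ and let $G$ be a subgroup of $\Sigma_n$ of the form $G=H\times\{1\}$ for some subgroup $H$ of $\Sigma_{n-1}$. Then the $G$-braid group of the torus satisfies $$\pi_1(F^{G}_n(S_1^0))\cong \pi_1(F^{H}_{n-1}(S_1^1))\times\mathbb{Z}^2.$$
   Context: $\Sigma_n$ is the symmetric group on $n$ symbols. For $H\leqslant\Sigma_{n-1}$, the group $H\times\{1\}\leqslant\Sigma_n$ acts by $H$ on the first $n-1$ symbols and fixes the last symbol. $S_g^n$ is the orientable surface of genus $g$ with $n$ punctures; $S_1^0$ is the torus and $S_1^1$ the once-punctured torus. For a space $X$, $F_n(X)=\{(x_1,\dots,x_n)\in X^n : x_i\neq x_j \text{ for } i\ne j\}$, with $F_0(X)$ a single point. A subgroup $G\leqslant\Sigma_n$ acts freely on $F_n(X)$ by permuting coordinates, and $F_n^G(X)=F_n(X)/G$. The group $\pi_1(F_n^G(X))$ is the $G$-braid group of $X$ on $n$ strings. *)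

(* Defs.v *)
From HB Require Import structures.
From mathcomp Require Import all_boot all_order all_algebra all_fingroup.
From mathcomp Require Import generic_quotient.
From mathcomp Require Import all_classical all_reals all_analysis.
From mathcomp Require Import homotopy lra.
Set Implicit Arguments.
Unset Strict Implicit.
Unset Printing Implicit Defensive.
Import Order.TTheory GRing.Theory Num.Theory.
Import numFieldNormedType.Exports.

Local Open Scope classical_set_scope.
Local Open Scope ring_scope.
Local Open Scope quotient_scope.

Definition unit_interval (R : realType) : Type := [set` `[0 : R, 1]].

Section UnitInterval.
Variable R : realType.
Local Notation I := (unit_interval R).

HB.instance Definition _ := Topological.copy I (set_type [set` `[0 : R, 1]]).

Definition ival (t : I) : R := set_val t.

(* iproj is the retraction of R onto [0, 1]; it turns real expressions into
   elements of the subtype. *)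
Fact iproj_subproof (r : R) :
  Num.max 0 (Num.min 1 r) \in [set` `[0 : R, 1]].
Proof.
apply/mem_set; rewrite /= in_itv /= le_max lexx /= ge_max ler01 /=.
by rewrite ge_min lexx.
Qed.

Definition iproj (r : R) : I :=
  exist (fun x => x \in [set` `[0 : R, 1]]) _ (iproj_subproof r).

Lemma ival_itv (t : I) : 0 <= ival t <= 1.
Proof. by have /set_mem := svalP t; rewrite /= in_itv. Qed.

Lemma ival_ge0 (t : I) : 0 <= ival t.
Proof. by have /andP[] := ival_itv t. Qed.

Lemma ival_le1 (t : I) : ival t <= 1.
Proof. by have /andP[] := ival_itv t. Qed.

Lemma ival_inj : injective ival.
Proof. exact: val_inj. Qed.

Lemma iprojE (r : R) : ival (iproj r) = Num.max 0 (Num.min 1 r).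
Proof. by []. Qed.

Lemma iprojK (r : R) : 0 <= r <= 1 -> ival (iproj r) = r.
Proof. by move=> /andP[r0 r1]; rewrite iprojE min_r// max_r. Qed.

Lemma ivalK : cancel ival iproj.
Proof.
by move=> t; apply: ival_inj; rewrite iprojK// ival_ge0 ival_le1.
Qed.

Fact unit_interval_neq : iproj 0 != iproj 1.
Proof.
apply/eqP => /(congr1 ival); rewrite !iprojK ?lexx ?ler01//.
by move/eqP; rewrite eq_sym oner_eq0.
Qed.

HB.instance Definition _ := isBiPointed.Build I unit_interval_neq.

Lemma ival_zero : ival zero = 0.
Proof. by rewrite iprojK// lexx ler01. Qed.

Lemma ival_one : ival one = 1.
Proof. by rewrite iprojK// lexx ler01. Qed.

Lemma ival_continuous : continuous ival.
Proof. exact: initial_continuous. Qed.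

Lemma iproj_continuous : continuous iproj.
Proof.
apply/continuousP => A [B oB <-].
have c : continuous (fun r : R => Num.max 0 (Num.min 1 r)).
  move=> r; apply: (@continuous_max R R (fun=> 0)); first exact: cvg_cst.
  by apply: (@continuous_min R R (fun=> 1)); [exact: cvg_cst|exact: cvg_id].
by move/continuousP: c; apply.
Qed.

Lemma pasting (Z X : topologicalType) (u : Z -> R) (c : R) (f g : Z -> X) :
  continuous u -> continuous f -> continuous g ->
  (forall z, u z = c -> f z = g z) ->
  continuous (fun z => if u z <= c then f z else g z).
Proof.
move=> cu cf cg fg; apply/continuous_subspace_setT.
have -> : [set: Z] = [set z | u z <= c] `|` [set z | c <= u z].
  by apply/seteqP; split => z //= _; apply/orP; exact: le_total.
apply: withinU_continuous.
- by apply: (preimage_closed _ (@closed_le _ c)) => z _; exact: cu.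
- by apply: (preimage_closed _ (@closed_ge _ c)) => z _; exact: cu.
- apply: (@subspace_eq_continuous _ _ _ f); last exact: continuous_subspaceT.
  by move=> z /[!inE] /= uz; rewrite /from_subspace uz.
- apply: (@subspace_eq_continuous _ _ _ g); last exact: continuous_subspaceT.
  move=> z /[!inE] /= uz; rewrite /from_subspace; case: ifP => // uz'; apply/esym/fg.
  by apply/eqP; rewrite eq_le uz' uz.
Qed.

End UnitInterval.

Section Homotopy.
Variables (R : realType) (X : topologicalType).
Local Notation I := (unit_interval R).


(* Homotopy relative to the endpoints. *)
Definition path_homotopic (x y : X) (p q : {path I from x to y in X}) : Prop :=
  exists H : I * I -> X,
    [/\ continuous H,
        forall t, H (t, zero) = p t,
        forall t, H (t, one) = q t,
        forall s, H (zero, s) = x &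
        forall s, H (one, s) = y].

Definition path_cat_fun (x y z : X) (p : {path I from x to y in X})
    (q : {path I from y to z in X}) (t : I) : X :=
  if ival t <= 2^-1 then p (iproj (2 * ival t))
  else q (iproj (2 * ival t - 1)).

Definition path_rev_fun (x y : X) (p : {path I from x to y in X}) (t : I) : X :=
  p (iproj (1 - ival t)).

Let ivalC : continuous (@ival R). Proof. exact: ival_continuous. Qed.

Lemma iproj_comp_continuous (Z : topologicalType) (u : Z -> R) :
  continuous u -> continuous (fun z => iproj (u z)).
Proof. by move=> cu w; apply: continuous_comp; [exact: cu|exact: iproj_continuous]. Qed.

Lemma comp_iproj_continuous (Z Y : topologicalType) (f : I -> Y) (u : Z -> R) :
  continuous f -> continuous u -> continuous (fun z => f (iproj (u z))).
Proof.
move=> cf cu w; apply: (@continuous_comp _ _ _ (fun z => iproj (u z)) f).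
  exact: iproj_comp_continuous.
exact: cf.
Qed.

Section ScalarContinuity.
Variable Z : topologicalType.
Implicit Types u v : Z -> R.

Lemma addr_continuous u (c : R) :
  continuous u -> continuous (fun z => u z + c).
Proof.
move=> cu z; apply: (@continuousD R R^o Z u (fun=> c)); first exact: cu.
exact: cvg_cst.
Qed.

Lemma mulr_continuous u (c : R) :
  continuous u -> continuous (fun z => c * u z).
Proof.
by move=> cu z; apply: (@continuousM R Z (fun=> c) u); [exact: cvg_cst|exact: cu].
Qed.

Lemma mul2B1_continuous u : continuous u -> continuous (fun z => 2 * u z - 1).
Proof. by move=> cu; exact/addr_continuous/mulr_continuous. Qed.

Lemma onem_continuous u : continuous u -> continuous (fun z => 1 - u z).
Proof. by move=> cu z; apply: (@continuousB R R^o Z (fun=> 1) u); [exact: cvg_cst|exact: cu]. Qed.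

Lemma conv_continuous (s u v : Z -> R) : continuous s -> continuous u ->
  continuous v -> continuous (fun z => (1 - s z) * u z + s z * v z).
Proof.
move=> cs cu cv z.
apply: (@continuousD R R^o Z (fun z => (1 - s z) * u z) (fun z => s z * v z)).
  apply: (@continuousM R Z (fun z => 1 - s z) u); last exact: cu.
  exact: onem_continuous.
by apply: (@continuousM R Z s v); [exact: cs|exact: cv].
Qed.

Lemma pair_continuous (A B : topologicalType) (f : Z -> A) (g : Z -> B) :
  continuous f -> continuous g -> continuous (fun z => (f z, g z)).
Proof. by move=> cf cg z; apply: cvg_pair; [exact: cf|exact: cg]. Qed.

Lemma comp_continuous (A B : topologicalType) (f : A -> B) (g : Z -> A) :
  continuous f -> continuous g -> continuous (fun z => f (g z)).
Proof.
by move=> cf cg z; apply: (@continuous_comp _ _ _ g f); [exact: cg|exact: cf].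
Qed.

End ScalarContinuity.

Let fstC : continuous (fst : I * I -> I). Proof. by move=> ?; exact: cvg_fst. Qed.
Let sndC : continuous (snd : I * I -> I). Proof. by move=> ?; exact: cvg_snd. Qed.

Let ival1C : continuous (fun ts : I * I => ival ts.1).
Proof. exact: (comp_continuous ivalC fstC). Qed.

Let ival2C : continuous (fun ts : I * I => ival ts.2).
Proof. exact: (comp_continuous ivalC sndC). Qed.

Lemma path_cat_continuous (x y z : X) p q : continuous (@path_cat_fun x y z p q).
Proof.
apply: (@pasting R _ _ (@ival R) _ (fun t => p (iproj (2 * ival t)))
   (fun t => q (iproj (2 * ival t - 1)))) => //.
- apply: (@comp_iproj_continuous _ _ p); first exact: cts_fun.
  exact: mulr_continuous.
- apply: (@comp_iproj_continuous _ _ q); first exact: cts_fun.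
  exact: mul2B1_continuous.
- move=> t ->; rewrite divff ?pnatr_eq0// subrr.
  by rewrite (@path_one _ _ _ _ p) (@path_zero _ _ _ _ q).
Qed.

Lemma path_cat_zero (x y z : X) p q : @path_cat_fun x y z p q zero = x.
Proof.
by rewrite /path_cat_fun ival_zero invr_ge0 ler0n mulr0 (@path_zero _ _ _ _ p).
Qed.

Lemma path_cat_one (x y z : X) p q : @path_cat_fun x y z p q one = z.
Proof.
rewrite /path_cat_fun ival_one mulr1 ifF; last by apply/negbTE; rewrite -ltNge; lra.
have -> : 2 - 1 = 1 :> R by lra.
exact: (@path_one _ _ _ _ q).
Qed.

Lemma path_rev_continuous (x y : X) p : continuous (@path_rev_fun x y p).
Proof.
apply: (@comp_iproj_continuous _ _ p); first exact: cts_fun.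
exact: onem_continuous.
Qed.

Lemma path_rev_zero (x y : X) p : @path_rev_fun x y p zero = y.
Proof. by rewrite /path_rev_fun ival_zero subr0 (@path_one _ _ _ _ p). Qed.

Lemma path_rev_one (x y : X) p : @path_rev_fun x y p one = x.
Proof. by rewrite /path_rev_fun ival_one subrr (@path_zero _ _ _ _ p). Qed.

Definition path_cat (x y z : X) (p : {path I from x to y in X})
    (q : {path I from y to z in X}) : {path I from x to z in X} :=
  mk_path (@path_cat_continuous _ _ _ p q) (path_cat_zero p q)
    (path_cat_one p q).

Definition path_rev (x y : X) (p : {path I from x to y in X}) :
    {path I from y to x in X} :=
  mk_path (@path_rev_continuous _ _ p) (path_rev_zero p) (path_rev_one p).

Definition path_cst (x : X) : {path I from x to x in X} := cst x.

Lemma path_reparam_homotopic (x y : X) (p q : {path I from x to y in X})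
    (f : I -> X) (u v : I -> R) :
  continuous f -> continuous u -> continuous v ->
  u zero = v zero -> u one = v one ->
  (forall t, p t = f (iproj (u t))) -> (forall t, q t = f (iproj (v t))) ->
  path_homotopic p q.
Proof.
move=> cf cu cv uv0 uv1 pE qE.
exists (fun ts =>
  f (iproj ((1 - ival ts.2) * u ts.1 + ival ts.2 * v ts.1))); split => /=.
- apply: (@comp_iproj_continuous _ _ f) => //.
  apply: (@conv_continuous _ (fun ts : I * I => ival ts.2)
    (fun ts => u ts.1) (fun ts => v ts.1)) => //.
  + exact: (comp_continuous cu fstC).
  + exact: (comp_continuous cv fstC).
- by move=> t; rewrite ival_zero subr0 mul1r mul0r addr0 pE.
- by move=> t; rewrite ival_one subrr mul0r add0r mul1r qE.
- by move=> s; rewrite -uv0 -mulrDl subrK mul1r -pE path_zero.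
- by move=> s; rewrite -uv1 -mulrDl subrK mul1r -pE path_one.
Qed.

Lemma path_homotopic_refl (x y : X) (p : {path I from x to y in X}) :
  path_homotopic p p.
Proof.
apply: (@path_reparam_homotopic _ _ _ _ p (@ival R) (@ival R)) => //.
- exact: cts_fun.
- by move=> t; rewrite ivalK.
- by move=> t; rewrite ivalK.
Qed.

Lemma path_homotopic_sym (x y : X) (p q : {path I from x to y in X}) :
  path_homotopic p q -> path_homotopic q p.
Proof.
move=> [H [cH H0 H1 Hx Hy]].
exists (fun ts => H (ts.1, iproj (1 - ival ts.2))); split => //=.
- apply: (@comp_continuous _ _ _ H (fun ts => (ts.1, iproj (1 - ival ts.2)))) => //.
  apply: pair_continuous => //; apply: iproj_comp_continuous.
  exact: onem_continuous.
- by move=> t; rewrite ival_zero subr0 H1.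
- by move=> t; rewrite ival_one subrr H0.
Qed.

Lemma path_homotopic_trans (x y : X) (p q r : {path I from x to y in X}) :
  path_homotopic p q -> path_homotopic q r -> path_homotopic p r.
Proof.
move=> [H [cH H0 H1 Hx Hy]] [K [cK K0 K1 Kx Ky]].
exists (fun ts => if ival ts.2 <= 2^-1 then H (ts.1, iproj (2 * ival ts.2))
                  else K (ts.1, iproj (2 * ival ts.2 - 1))).
split => /=.
- apply: (@pasting R _ _ (fun ts : I * I => ival ts.2) _
      (fun ts => H (ts.1, iproj (2 * ival ts.2)))
      (fun ts => K (ts.1, iproj (2 * ival ts.2 - 1)))) => //.
  + apply: (@comp_continuous _ _ _ H (fun ts => (ts.1, iproj (2 * ival ts.2)))) => //.
    apply: pair_continuous => //; apply: iproj_comp_continuous.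
    exact: mulr_continuous.
  + apply: (@comp_continuous _ _ _ K
      (fun ts => (ts.1, iproj (2 * ival ts.2 - 1)))) => //.
    apply: pair_continuous => //; apply: iproj_comp_continuous.
    exact: mul2B1_continuous.
  + by move=> ts ->; rewrite divff ?pnatr_eq0// subrr H1 K0.
- by move=> t; rewrite ival_zero invr_ge0 ler0n mulr0 H0.
- move=> t; rewrite ival_one mulr1 ifF; last by apply/negbTE; rewrite -ltNge; lra.
  have -> : 2 - 1 = 1 :> R by lra.
  exact: K1.
- by move=> s; case: ifP => _; rewrite ?Hx ?Kx.
- by move=> s; case: ifP => _; rewrite ?Hy ?Ky.
Qed.

Lemma path_cat_homotopic (x y z : X) (p p' : {path I from x to y in X})
    (q q' : {path I from y to z in X}) :
  path_homotopic p p' -> path_homotopic q q' ->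
  path_homotopic (path_cat p q) (path_cat p' q').
Proof.
move=> [H [cH H0 H1 Hx Hy]] [K [cK K0 K1 Kx Ky]].
exists (fun ts => if ival ts.1 <= 2^-1 then H (iproj (2 * ival ts.1), ts.2)
                  else K (iproj (2 * ival ts.1 - 1), ts.2)).
split => /=.
- apply: (@pasting R _ _ (fun ts : I * I => ival ts.1) _
      (fun ts => H (iproj (2 * ival ts.1), ts.2))
      (fun ts => K (iproj (2 * ival ts.1 - 1), ts.2))) => //.
  + apply: (@comp_continuous _ _ _ H (fun ts => (iproj (2 * ival ts.1), ts.2))) => //.
    apply: pair_continuous => //; apply: iproj_comp_continuous.
    exact: mulr_continuous.
  + apply: (@comp_continuous _ _ _ K
      (fun ts => (iproj (2 * ival ts.1 - 1), ts.2))) => //.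
    apply: pair_continuous => //; apply: iproj_comp_continuous.
    exact: mul2B1_continuous.
  + by move=> ts ->; rewrite divff ?pnatr_eq0// subrr Hy Kx.
- by move=> t; rewrite /mk_path /path_cat_fun; case: ifP; rewrite ?H0 ?K0.
- by move=> t; rewrite /mk_path /path_cat_fun; case: ifP; rewrite ?H1 ?K1.
- by move=> s; rewrite ival_zero invr_ge0 ler0n mulr0 Hx.
- move=> s; rewrite ival_one mulr1 ifF; last by apply/negbTE; rewrite -ltNge; lra.
  have -> : 2 - 1 = 1 :> R by lra.
  exact: Ky.
Qed.

Lemma path_rev_homotopic (x y : X) (p q : {path I from x to y in X}) :
  path_homotopic p q -> path_homotopic (path_rev p) (path_rev q).
Proof.
move=> [H [cH H0 H1 Hx Hy]].
exists (fun ts => H (iproj (1 - ival ts.1), ts.2)); split => /=.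
- apply: (@comp_continuous _ _ _ H (fun ts => (iproj (1 - ival ts.1), ts.2))) => //.
  apply: pair_continuous => //; apply: iproj_comp_continuous.
  exact: onem_continuous.
- by move=> t; rewrite H0.
- by move=> t; rewrite H1.
- by move=> s; rewrite ival_zero subr0 Hy.
- by move=> s; rewrite ival_one subrr Hx.
Qed.

End Homotopy.

Section FundamentalGroup.
Variables (R : realType) (X : topologicalType).
Local Notation I := (unit_interval R).

Lemma path_catA (x y z w : X) (p : {path I from x to y in X})
    (q : {path I from y to z in X}) (r : {path I from z to w in X}) :
  path_homotopic (path_cat p (path_cat q r)) (path_cat (path_cat p q) r).
Proof.
apply: path_homotopic_sym.
pose u (t : I) : R :=
  Num.min (2 * ival t) (Num.min (ival t + 4^-1) (2^-1 * ival t + 2^-1)).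
have ci : continuous (@ival R) by exact: ival_continuous.
apply: (@path_reparam_homotopic _ _ _ _ _ _
  (path_cat p (path_cat q r)) u (@ival R)) => //.
- exact: cts_fun.
- move=> t; apply: (@continuous_min R I (fun t => 2 * ival t)).
    exact: mulr_continuous.
  apply: (@continuous_min R I (fun t => ival t + 4^-1)).
    exact: addr_continuous.
  exact/addr_continuous/mulr_continuous.
- by rewrite /u !ival_zero min_l ?mulr0// le_min; apply/andP; split; lra.
- rewrite /u !ival_one min_r; last by rewrite ge_min; apply/orP; right; lra.
  by rewrite min_r; lra.
- move=> t; have := ival_ge0 t; have := ival_le1 t.
  rewrite /= /mk_path /path_cat_fun /u; move: (ival t) => a a1 a0.
  have [a2|a2] := leP a 2^-1.
    rewrite /= /mk_path /path_cat_fun (@iprojK _ (2 * a)); last by apply/andP; split; lra.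
    have [a4|a4] := leP (2 * a) 2^-1.
      rewrite min_l; last by rewrite le_min; apply/andP; split; lra.
      by rewrite (@iprojK _ (2 * a)) ?a4//; apply/andP; split; lra.
    rewrite min_r; last by rewrite ge_min; apply/orP; left; lra.
    rewrite min_l; last lra.
    rewrite (@iprojK _ (a + 4^-1)); last by apply/andP; split; lra.
    rewrite ifF; last by apply/negbTE; rewrite -ltNge; lra.
    rewrite (@iprojK _ (2 * (a + _) - 1)); last by apply/andP; split; lra.
    rewrite ifT; last lra.
    by congr (q (iproj _)); lra.
  rewrite min_r; last by rewrite ge_min; apply/orP; right; lra.
  rewrite min_r; last lra.
  rewrite (@iprojK _ (2^-1 * a + _)); last by apply/andP; split; lra.
  rewrite ifF; last by apply/negbTE; rewrite -ltNge; lra.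
  rewrite /= /mk_path /path_cat_fun.
  rewrite (@iprojK _ (2 * (2^-1 * a + _) - 1)); last by apply/andP; split; lra.
  rewrite ifF; last by apply/negbTE; rewrite -ltNge; lra.
  by congr (r (iproj _)); lra.
- by move=> t; rewrite ivalK.
Qed.

Lemma path_cst_cat (x y : X) (p : {path I from x to y in X}) :
  path_homotopic (path_cat (path_cst R x) p) p.
Proof.
pose u (t : I) : R := Num.max 0 (2 * ival t - 1).
have ci : continuous (@ival R) by exact: ival_continuous.
apply: (@path_reparam_homotopic _ _ _ _ _ _ p u (@ival R)) => //.
- exact: cts_fun.
- move=> t; apply: (@continuous_max R I (fun=> 0)); first exact: (@cst_continuous I R).
  exact: mul2B1_continuous.
- by rewrite /u !ival_zero max_l//; lra.
- by rewrite /u !ival_one max_r//; lra.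
- move=> t; rewrite /= /mk_path /path_cat_fun /u.
  case: ifP => a2.
    rewrite max_l; last lra.
    by rewrite (@path_zero _ _ _ _ p).
  by rewrite max_r//; have /negbT := a2; rewrite -ltNge; lra.
- by move=> t; rewrite ivalK.
Qed.

Lemma path_cat_cst (x y : X) (p : {path I from x to y in X}) :
  path_homotopic (path_cat p (path_cst R y)) p.
Proof.
pose u (t : I) : R := Num.min 1 (2 * ival t).
have ci : continuous (@ival R) by exact: ival_continuous.
apply: (@path_reparam_homotopic _ _ _ _ _ _ p u (@ival R)) => //.
- exact: cts_fun.
- move=> t; apply: (@continuous_min R I (fun=> 1)); first exact: (@cst_continuous I R).
  exact: mulr_continuous.
- by rewrite /u !ival_zero min_r//; lra.
- by rewrite /u !ival_one min_l//; lra.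
- move=> t; rewrite /= /mk_path /path_cat_fun /u.
  case: ifP => a2.
    by rewrite min_r//; lra.
  rewrite min_l; last by have /negbT := a2; rewrite -ltNge; lra.
  by rewrite (@path_one _ _ _ _ p).
- by move=> t; rewrite ivalK.
Qed.

Lemma path_rev_cat (x y : X) (p : {path I from x to y in X}) :
  path_homotopic (path_cat (path_rev p) p) (path_cst R y).
Proof.
pose u (t : I) : R := `|1 - 2 * ival t|.
have ci : continuous (@ival R) by exact: ival_continuous.
apply: (@path_reparam_homotopic _ _ _ _ _ _ p u (fun=> 1)) => //.
- exact: cts_fun.
- apply: (@comp_continuous _ _ _ (@Num.norm R R) (fun t => 1 - 2 * ival t)).
    exact: norm_continuous.
  exact/onem_continuous/mulr_continuous.
- by move=> t; exact: (@cst_continuous I R).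
- by rewrite /u ival_zero mulr0 subr0 normr1.
- by rewrite /u ival_one mulr1 distrC [2 - 1](_ : _ = 1) ?normr1//; lra.
- move=> t; have := ival_ge0 t; have := ival_le1 t.
  rewrite /= /mk_path /path_cat_fun /u; move: (ival t) => a a1 a0.
  case: ifP => a2.
    rewrite ger0_norm; last lra.
    rewrite /= /mk_path /path_rev_fun iprojK//; apply/andP; split; lra.
  have {}a2 : 2^-1 < a by rewrite ltNge a2.
  by rewrite ler0_norm ?opprB//; lra.
- by move=> t; rewrite (@path_one _ _ _ _ p).
Qed.

Lemma path_cat_rev (x y : X) (p : {path I from x to y in X}) :
  path_homotopic (path_cat p (path_rev p)) (path_cst R x).
Proof.
pose u (t : I) : R := 1 - `|1 - 2 * ival t|.
have ci : continuous (@ival R) by exact: ival_continuous.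
apply: (@path_reparam_homotopic _ _ _ _ _ _ p u (fun=> 0)) => //.
- exact: cts_fun.
- apply: onem_continuous.
  apply: (@comp_continuous _ _ _ (@Num.norm R R) (fun t => 1 - 2 * ival t)).
    exact: norm_continuous.
  exact/onem_continuous/mulr_continuous.
- by move=> t; exact: (@cst_continuous I R).
- by rewrite /u ival_zero mulr0 subr0 normr1 subrr.
- by rewrite /u ival_one mulr1 distrC [2 - 1](_ : _ = 1) ?normr1 ?subrr//; lra.
- move=> t; have := ival_ge0 t; have := ival_le1 t.
  rewrite /= /mk_path /path_cat_fun /u; move: (ival t) => a a1 a0.
  case: ifP => a2.
    by rewrite ger0_norm ?subKr//; lra.
  have {}a2 : 2^-1 < a by rewrite ltNge a2.
  rewrite ler0_norm; last lra.
  rewrite /= /mk_path /path_rev_fun iprojK; last by apply/andP; split; lra.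
  by congr (p (iproj _)); lra.
- by move=> t; rewrite (@path_zero _ _ _ _ p).
Qed.

Section BasePoint.
Variable x : X.
Local Notation loop := {path I from x to x in X}.

Definition loop_homotopicb (p q : loop) : bool := `[< path_homotopic p q >].

Fact loop_homotopicb_refl : reflexive loop_homotopicb.
Proof. by move=> p; apply/asboolP/path_homotopic_refl. Qed.

Fact loop_homotopicb_sym : symmetric loop_homotopicb.
Proof. by move=> p q; apply/asboolP/asboolP; exact: path_homotopic_sym. Qed.

Fact loop_homotopicb_trans : transitive loop_homotopicb.
Proof.
move=> q p r /asboolP pq /asboolP qr; apply/asboolP.
exact: path_homotopic_trans pq qr.
Qed.

Canonical loop_homotopic_equiv := EquivRel loop_homotopicb
  loop_homotopicb_refl loop_homotopicb_sym loop_homotopicb_trans.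

Definition pi1 : Type := {eq_quot loop_homotopic_equiv}.

HB.instance Definition _ := Choice.copy pi1 {eq_quot loop_homotopic_equiv}.
HB.instance Definition _ := EqQuotient.copy pi1 {eq_quot loop_homotopic_equiv}.

Lemma pi1P (p q : loop) : path_homotopic p q <-> \pi_pi1 p = \pi_pi1 q.
Proof.
split=> [pq|/eqmodP/asboolP //].
exact/eqmodP/asboolP.
Qed.

Lemma pi1_repr (p : loop) : path_homotopic (repr (\pi_pi1 p)) p.
Proof. by apply/pi1P; rewrite reprK. Qed.

Definition pi1_one : pi1 := \pi_pi1 (path_cst R x).
Definition pi1_mul (a b : pi1) : pi1 := \pi_pi1 (path_cat (repr a) (repr b)).
Definition pi1_inv (a : pi1) : pi1 := \pi_pi1 (path_rev (repr a)).

Lemma pi1_mulE (p q : loop) :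
  pi1_mul (\pi_pi1 p) (\pi_pi1 q) = \pi_pi1 (path_cat p q).
Proof. by apply/pi1P/path_cat_homotopic; exact: pi1_repr. Qed.

Lemma pi1_invE (p : loop) : pi1_inv (\pi_pi1 p) = \pi_pi1 (path_rev p).
Proof. by apply/pi1P/path_rev_homotopic; exact: pi1_repr. Qed.

Fact pi1_mulA : associative pi1_mul.
Proof.
elim/quotW=> p; elim/quotW=> q; elim/quotW=> r.
rewrite (pi1_mulE q r) (pi1_mulE p q) (pi1_mulE p (path_cat q r)).
by rewrite (pi1_mulE (path_cat p q) r); apply/pi1P; exact: path_catA.
Qed.

Fact pi1_mul1 : left_id pi1_one pi1_mul.
Proof. by elim/quotW=> p; rewrite pi1_mulE; apply/pi1P/path_cst_cat. Qed.

Fact pi1_mulr1 : right_id pi1_one pi1_mul.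
Proof. by elim/quotW=> p; rewrite pi1_mulE; apply/pi1P/path_cat_cst. Qed.

Fact pi1_mulV : left_inverse pi1_one pi1_inv pi1_mul.
Proof.
by elim/quotW=> p; rewrite pi1_invE pi1_mulE; apply/pi1P/path_rev_cat.
Qed.

Fact pi1_mulrV : right_inverse pi1_one pi1_inv pi1_mul.
Proof.
by elim/quotW=> p; rewrite pi1_invE pi1_mulE; apply/pi1P/path_cat_rev.
Qed.

HB.instance Definition _ := isGroup.Build pi1
  pi1_mulA pi1_mul1 pi1_mulr1 pi1_mulV pi1_mulrV.

End BasePoint.
End FundamentalGroup.

Section Configuration.
Variables (X : topologicalType) (n : nat).

(* F_n(X), as a subspace of the product X^n. *)
Definition configuration : Type :=
  [set x : prod_topology (fun=> X) | injective (x : 'I_n -> X)].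

HB.instance Definition _ := Topological.copy configuration
  (set_type [set x : prod_topology (fun=> X) | injective (x : 'I_n -> X)]).

Definition point_of (x : configuration) (i : 'I_n) : X := set_val x i.

Variable G : {group 'S_n}.

Definition same_orbitb (x y : configuration) : bool :=
  `[< exists2 s : 'S_n, s \in G & forall i, point_of y i = point_of x (s i) >].

Fact same_orbitb_refl : reflexive same_orbitb.
Proof.
by move=> x; apply/asboolP; exists 1%g => [|i]; rewrite ?group1// perm1.
Qed.

Fact same_orbitb_sym : symmetric same_orbitb.
Proof.
move=> x y; apply/asboolP/asboolP => -[s sG E]; exists s^-1%g;
  by rewrite ?groupV// => i; rewrite E permKV.
Qed.

Fact same_orbitb_trans : transitive same_orbitb.
Proof.
move=> y x z /asboolP[s sG ys] /asboolP[t tG zt]; apply/asboolP.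
by exists (t * s)%g => [|i]; rewrite ?groupM// permM zt ys.
Qed.

Canonical same_orbit_equiv :=
  EquivRel same_orbitb same_orbitb_refl same_orbitb_sym same_orbitb_trans.

(* F_n^G(X) = F_n(X)/G with the quotient topology. *)
Definition orbit_configuration : topologicalType :=
  quotient_topology {eq_quot same_orbit_equiv}.

End Configuration.

(* H x {1}: lift_perm ord_max ord_max s fixes the last symbol ord_max and acts
   as s on the remaining ones. *)
Definition times_one (n : nat) (H : {set 'S_n}) : {set 'S_n.+1} :=
  (lift_perm ord_max ord_max @: H)%SET.

Section Surfaces.
Variable R : realType.

Definition circle : Type := [set z : R * R | z.1 ^+ 2 + z.2 ^+ 2 = 1].

HB.instance Definition _ := Topological.copy circle
  (set_type [set z : R * R | z.1 ^+ 2 + z.2 ^+ 2 = 1]).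

Definition torus : topologicalType := (circle * circle)%type.

Definition punctured_torus (p : torus) : topologicalType := [set~ p].

End Surfaces.

(* Main.v *)
(* The torus T is a group, so (x_1, ..., x_{n+1}) can be translated until its
   last point is the puncture o: x |-> (x_{n+1}, (x_i - x_{n+1} + o)_i) is a
   homeomorphism F_{n+1}(T) = T x F_n(T - o), equivariant for G = H x 1 acting on
   the second factor only. It descends to the orbit spaces, and pi_1 of the
   product is pi_1(T) = Z^2 times pi_1(F_n^H(T - o)). The base points are
   arbitrary because F_n(T - o) is path connected. *)

Require Import Defs.
From mathcomp Require Import all_boot all_order all_algebra all_fingroup.
From mathcomp Require Import generic_quotient.
From mathcomp Require Import all_classical all_reals all_analysis.
From mathcomp Require Import homotopy lra ring.
From Corelib Require RelationClasses Morphisms Setoid.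
Set Implicit Arguments.
Unset Strict Implicit.
Unset Printing Implicit Defensive.
Import Order.TTheory GRing.Theory Num.Theory.
Import numFieldNormedType.Exports.

Local Open Scope classical_set_scope.
Local Open Scope ring_scope.
Local Open Scope quotient_scope.

(** Only the second factor needs a change of base point: winding numbers describe pi_1 of a circle
    at every base point, whereas the homeomorphism sends [x] to a base point of the orbit space that
    is unrelated to [y]. Conjugation by a path between the two closes the gap. Connectedness is
    needed for configurations, not only for the torus minus finitely many points: points move one at
    a time, through an auxiliary configuration that avoids both ends. The delicate half of the
    descent is the inverse homeomorphism, whose source is T times a quotient: the product of a
    quotient map with an identity need not be a quotient map, but the projection to orbits is open,
    and openness passes to products. Winding numbers rest on lifting maps of the square through the
    exponential. Their uniqueness and homotopy invariance both come from one fact: a continuous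
    function with values in the multiples of some c > 0 agrees at the two ends of the interval. *)

Lemma inj_surj_bij (A B : Type) (f : A -> B) :
  injective f -> (forall b, exists a, f a = b) -> bijective f.
Proof. by move=> fI /choice[g gK]; exists g => // a; apply: fI; rewrite gK. Qed.

(** * Fundamental groups: change of base point, functoriality, products *)

Section Pi1.
Variable R : realType.
Local Notation I := (unit_interval R).

Section Groupoid.
Variable X : topologicalType.

(** Together with the next instance, this makes homotopies usable for rewriting inside
    concatenations, so that groupoid identities become manipulations of words. *)
#[local] Instance path_homotopic_equivalence (x y : X) :
  RelationClasses.Equivalence (@path_homotopic R X x y).
Proof.
split => [p|p q|p q r]; [exact: path_homotopic_refl|exact: path_homotopic_sym|].
exact: path_homotopic_trans.
Qed.

#[local] Instance path_cat_proper (x y z : X) :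
  Morphisms.Proper (Morphisms.respectful (@path_homotopic R X x y)
    (Morphisms.respectful (@path_homotopic R X y z)
      (@path_homotopic R X x z))) (@path_cat R X x y z).
Proof. by move=> p p' pp' q q' qq'; exact: path_cat_homotopic. Qed.


#[local] Hint Resolve path_homotopic_refl : core.
Lemma path_rev_catK (x y z : X) (p : {path I from x to y in X})
    (q : {path I from y to z in X}) :
  path_homotopic (path_cat (path_rev p) (path_cat p q)) q.
Proof. by rewrite path_catA path_rev_cat path_cst_cat. Qed.

Lemma path_cat_revK (x y z : X) (p : {path I from x to y in X})
    (q : {path I from x to z in X}) :
  path_homotopic (path_cat p (path_cat (path_rev p) q)) q.
Proof. by rewrite path_catA path_cat_rev path_cst_cat. Qed.

(** A strict equality, not just a homotopy, since 1 - (1 - t) = t; this is what allows conjugation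
    by the reversed path to be rewritten as an inverse. *)
Lemma path_revK (x y : X) (p : {path I from x to y in X}) :
  path_rev (path_rev p) = p.
Proof.
apply/path_eqP => t; rewrite /= /mk_path /path_rev_fun /= /mk_path /path_rev_fun.
have /andP[t0 t1] := ival_itv t.
rewrite iprojK ?subKr ?ivalK//; apply/andP; split; lra.
Qed.

Lemma pi1_mulgE (x : X) (p q : {path I from x to x in X}) :
  (\pi_(pi1 R x) p * \pi_(pi1 R x) q)%g = \pi_(pi1 R x) (path_cat p q).
Proof. exact: pi1_mulE. Qed.

Definition pi1_conj (x y : X) (c : {path I from x to y in X}) (a : pi1 R x) :
    pi1 R y :=
  \pi_(pi1 R y) (path_cat (path_rev c) (path_cat (repr a) c)).

Lemma pi1_conjE (x y : X) (c : {path I from x to y in X})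
    (p : {path I from x to x in X}) :
  pi1_conj c (\pi_(pi1 R x) p) =
  \pi_(pi1 R y) (path_cat (path_rev c) (path_cat p c)).
Proof. by apply/pi1P; rewrite (pi1_repr p). Qed.

Lemma pi1_conjM (x y : X) (c : {path I from x to y in X}) (a b : pi1 R x) :
  pi1_conj c (a * b)%g = (pi1_conj c a * pi1_conj c b)%g.
Proof.
elim/quotW: a => p; elim/quotW: b => q.
rewrite pi1_mulgE !pi1_conjE pi1_mulgE.
by apply/pi1P; rewrite -!path_catA path_cat_revK.
Qed.

Lemma pi1_conj_bij (x y : X) (c : {path I from x to y in X}) :
  bijective (pi1_conj c).
Proof.
exists (pi1_conj (path_rev c)); elim/quotW=> p; rewrite !pi1_conjE path_revK;
  apply/pi1P; rewrite -!path_catA.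
  by rewrite path_cat_rev path_cat_revK path_cat_cst; exact: pi1_repr.
by rewrite path_rev_cat path_rev_catK path_cat_cst; exact: pi1_repr.
Qed.

End Groupoid.

Section Functor.
Variables (X Y : topologicalType) (f : X -> Y).
Hypothesis cf : continuous f.

Lemma path_image_continuous (x y : X) (p : {path I from x to y in X}) :
  continuous (f \o p).
Proof. by apply: (comp_continuous (f := f)) => //; exact: cts_fun. Qed.

Lemma path_image_zero (x y : X) (p : {path I from x to y in X}) :
  (f \o p) zero = f x.
Proof. by rewrite /= (@path_zero _ _ _ _ p). Qed.

Lemma path_image_one (x y : X) (p : {path I from x to y in X}) :
  (f \o p) one = f y.
Proof. by rewrite /= (@path_one _ _ _ _ p). Qed.

Definition path_image (x y : X) (p : {path I from x to y in X}) :
    {path I from f x to f y in Y} :=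
  mk_path (@path_image_continuous _ _ p) (path_image_zero p) (path_image_one p).

Lemma path_image_homotopic (x y : X) (p q : {path I from x to y in X}) :
  path_homotopic p q -> path_homotopic (path_image p) (path_image q).
Proof.
move=> [H [cH H0 H1 Hx Hy]]; exists (f \o H); split => [|t|t|s|s] /=.
- exact: (comp_continuous (f := f)).
- by rewrite H0.
- by rewrite H1.
- by rewrite Hx.
- by rewrite Hy.
Qed.

Lemma path_image_cat (x y z : X) (p : {path I from x to y in X})
    (q : {path I from y to z in X}) :
  path_image (path_cat p q) = path_cat (path_image p) (path_image q).
Proof.
by apply/path_eqP => t; rewrite /= /mk_path /= /mk_path /path_cat_fun; case: ifP.
Qed.

Definition pi1_map (x : X) (a : pi1 R x) : pi1 R (f x) :=
  \pi_(pi1 R (f x)) (path_image (repr a)).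

Lemma pi1_mapE (x : X) (p : {path I from x to x in X}) :
  pi1_map (\pi_(pi1 R x) p) = \pi_(pi1 R (f x)) (path_image p).
Proof. by apply/pi1P/path_image_homotopic/pi1_repr. Qed.

Lemma pi1_mapM (x : X) (a b : pi1 R x) :
  pi1_map (a * b)%g = (pi1_map a * pi1_map b)%g.
Proof.
elim/quotW: a => p; elim/quotW: b => q.
by rewrite pi1_mulgE !pi1_mapE pi1_mulgE path_image_cat.
Qed.

(** Functoriality is not applied to [g]: its induced map lands at the base point [g (f x)], which is
    equal to [x] but gives a different type. Composing loops and homotopies with [g] by hand yields
    loops based at [x] itself. *)
Lemma pi1_map_bij (g : Y -> X) (x : X) :
  continuous g -> cancel f g -> cancel g f -> bijective (@pi1_map x).
Proof.
move=> cg fK gK; apply: inj_surj_bij => [a b|].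
  elim/quotW: a => p; elim/quotW: b => q.
  rewrite !pi1_mapE => /pi1P[H [cH H0 H1 Hx Hy]]; apply/pi1P.
  exists (g \o H); split => [|t|t|s|s] /=; rewrite ?H0 ?H1 ?Hx ?Hy ?fK//.
  exact: (comp_continuous (f := g)).
elim/quotW=> q.
have cgq : continuous (g \o q) by apply: (comp_continuous (f := g)) => //; exact: cts_fun.
have gq0 : (g \o q) zero = x by rewrite /= (@path_zero _ _ _ _ q).
have gq1 : (g \o q) one = x by rewrite /= (@path_one _ _ _ _ q).
exists (\pi_(pi1 R x) (mk_path cgq gq0 gq1)); rewrite pi1_mapE; congr (\pi_ _ _).
by apply/path_eqP => t; exact: gK.
Qed.

End Functor.

Section Product.
Variables X Y : topologicalType.

Lemma fst_continuous : continuous (@fst X Y).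
Proof. by move=> ?; exact: cvg_fst. Qed.

Lemma snd_continuous : continuous (@snd X Y).
Proof. by move=> ?; exact: cvg_snd. Qed.

Definition pi1_pair (z : X * Y) (a : pi1 R z) : pi1 R z.1 * pi1 R z.2 :=
  (pi1_map fst_continuous a, pi1_map snd_continuous a).

(** Loops and homotopies in a product are pairs of loops and of homotopies. *)
Lemma pi1_pair_bij (z : X * Y) : bijective (@pi1_pair z).
Proof.
apply: inj_surj_bij => [a b|[]].
  elim/quotW: a => p; elim/quotW: b => q.
  rewrite /pi1_pair !pi1_mapE => -[].
  move=> /pi1P[H [cH H0 H1 Hx Hy]] /pi1P[K [cK K0 K1 Kx Ky]]; apply/pi1P.
  exists (fun ts => (H ts, K ts)); split => [|t|t|s|s];
    rewrite ?H0 ?H1 ?Hx ?Hy ?K0 ?K1 ?Kx ?Ky -?surjective_pairing//.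
  exact: pair_continuous.
elim/quotW=> p; elim/quotW=> q.
have c : continuous (fun t => (p t, q t)) by apply: pair_continuous; exact: cts_fun.
have c0 : (p zero, q zero) = z.
  by rewrite (@path_zero _ _ _ _ p) (@path_zero _ _ _ _ q) -surjective_pairing.
have c1 : (p one, q one) = z.
  by rewrite (@path_one _ _ _ _ p) (@path_one _ _ _ _ q) -surjective_pairing.
exists (\pi_(pi1 R z) (mk_path c c0 c1)); rewrite /pi1_pair !pi1_mapE.
by congr (\pi_ _ _, \pi_ _ _); apply/path_eqP.
Qed.

End Product.
End Pi1.

(** * Continuity into subspaces; the circle group and its exponential *)

Lemma subtype_continuous (Z X : topologicalType) (A : set X)
    (f : Z -> set_type A) :
  continuous (fun z => set_val (f z)) -> continuous f.
Proof.
move=> cf; apply/continuousP => _ [B oB <-].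
by move/continuousP: cf => /(_ B oB).
Qed.

Section RealContinuity.
Variables (R : realType) (Z : topologicalType) (u v : Z -> R).
Hypotheses (cu : continuous u) (cv : continuous v).

Lemma real_continuousM : continuous (fun z => u z * v z).
Proof. by move=> z; apply: (@continuousM R Z u v); [exact: cu|exact: cv]. Qed.

Lemma real_continuousD : continuous (fun z => u z + v z).
Proof. by move=> z; apply: (@continuousD R R^o Z u v); [exact: cu|exact: cv]. Qed.

Lemma real_continuousB : continuous (fun z => u z - v z).
Proof. by move=> z; apply: (@continuousB R R^o Z u v); [exact: cu|exact: cv]. Qed.

End RealContinuity.

Section Circle.
Variable R : realType.
Local Notation S1 := (circle R).

Definition Circle (z : R * R) (h : z.1 ^+ 2 + z.2 ^+ 2 = 1) : S1 :=
  exist _ z (mem_set h).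

Definition re (a : S1) : R := (set_val a : R * R).1.
Definition im (a : S1) : R := (set_val a : R * R).2.

Lemma re_im (a : S1) : re a ^+ 2 + im a ^+ 2 = 1.
Proof. exact: (set_valP a). Qed.

Lemma circle_eq (a b : S1) : re a = re b -> im a = im b -> a = b.
Proof.
move=> h1 h2; apply: val_inj; rewrite [LHS]surjective_pairing [RHS]surjective_pairing.
by congr (_, _).
Qed.

Lemma re_continuous : continuous re.
Proof.
apply: (comp_continuous (f := fst)); first exact: fst_continuous.
exact: initial_continuous.
Qed.

Lemma im_continuous : continuous im.
Proof.
apply: (comp_continuous (f := snd)); first exact: snd_continuous.
exact: initial_continuous.
Qed.

Lemma circle_continuous (Z : topologicalType) (f : Z -> S1) :
  continuous (fun z => re (f z)) -> continuous (fun z => im (f z)) ->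
  continuous f.
Proof.
move=> cr ci; apply: subtype_continuous.
rewrite (_ : (fun z => _) = (fun z => (re (f z), im (f z)))).
  exact: pair_continuous.
by apply/funext => z; rewrite -surjective_pairing.
Qed.

Fact circle_mul_subproof (a b : S1) :
  (re a * re b - im a * im b, re a * im b + im a * re b).1 ^+ 2 +
  (re a * re b - im a * im b, re a * im b + im a * re b).2 ^+ 2 = 1.
Proof.
rewrite /= -[RHS](mulr1 1) -{1}(re_im a) -(re_im b); ring.
Qed.

Definition cmul (a b : S1) : S1 := Circle (circle_mul_subproof a b).

Fact circle_inv_subproof (a : S1) :
  (re a, - im a).1 ^+ 2 + (re a, - im a).2 ^+ 2 = 1.
Proof. by rewrite /= sqrrN re_im. Qed.

Definition cinv (a : S1) : S1 := Circle (circle_inv_subproof a).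

Fact circle_one_subproof : (1 : R, 0 : R).1 ^+ 2 + (1 : R, 0 : R).2 ^+ 2 = 1.
Proof. by rewrite /= expr1n expr0n /= addr0. Qed.

Definition cone : S1 := Circle circle_one_subproof.

Lemma re_mul (a b : S1) : re (cmul a b) = re a * re b - im a * im b.
Proof. by []. Qed.

Lemma im_mul (a b : S1) : im (cmul a b) = re a * im b + im a * re b.
Proof. by []. Qed.

Lemma cmulC : commutative cmul.
Proof. by move=> a b; apply: circle_eq; rewrite ?re_mul ?im_mul; ring. Qed.

Lemma cmulA : associative cmul.
Proof. by move=> a b c; apply: circle_eq; rewrite ?(re_mul, im_mul); ring. Qed.

Lemma cmul1 : left_id cone cmul.
Proof.
by move=> a; apply: circle_eq; rewrite ?(re_mul, im_mul) /re /im /=; ring.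
Qed.

Lemma cmulV : left_inverse cone cinv cmul.
Proof.
move=> a; apply: circle_eq; rewrite ?(re_mul, im_mul).
  by transitivity (re a ^+ 2 + im a ^+ 2); [rewrite /re /im /=; ring|exact: re_im].
by rewrite /re /im /=; ring.
Qed.

Lemma cmulK (a b : S1) : cmul (cinv a) (cmul a b) = b.
Proof. by rewrite cmulA cmulV cmul1. Qed.

Lemma cmulVK (a b : S1) : cmul a (cmul (cinv a) b) = b.
Proof. by rewrite cmulA (cmulC a) cmulV cmul1. Qed.

Lemma cmul_continuous (Z : topologicalType) (f g : Z -> S1) :
  continuous f -> continuous g -> continuous (fun z => cmul (f z) (g z)).
Proof.
move=> cf cg.
have [rf jf] : continuous (fun z => re (f z)) /\ continuous (fun z => im (f z)).
  by split; apply: comp_continuous => //; [exact: re_continuous|exact: im_continuous].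
have [rg jg] : continuous (fun z => re (g z)) /\ continuous (fun z => im (g z)).
  by split; apply: comp_continuous => //; [exact: re_continuous|exact: im_continuous].
apply: circle_continuous.
  exact: (real_continuousB (real_continuousM rf rg) (real_continuousM jf jg)).
exact: (real_continuousD (real_continuousM rf jg) (real_continuousM jf rg)).
Qed.

Lemma cinv_continuous : continuous cinv.
Proof.
apply: circle_continuous; first exact: re_continuous.
move=> z; apply: (@continuousN R R^o); exact: im_continuous.
Qed.

Fact circle_exp_subproof (t : R) : (cos t, sin t).1 ^+ 2 + (cos t, sin t).2 ^+ 2 = 1.
Proof. exact: cos2Dsin2. Qed.

Definition cexp (t : R) : S1 := Circle (circle_exp_subproof t).

Lemma cexp_continuous : continuous cexp.
Proof. by apply: circle_continuous; [exact: continuous_cos|exact: continuous_sin]. Qed.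

Lemma cexpD (s t : R) : cexp (s + t) = cmul (cexp s) (cexp t).
Proof.
by apply: circle_eq; rewrite ?(re_mul, im_mul) /re /im /= ?cosD ?sinD// addrC; congr (_ + _).
Qed.

Lemma cexp0 : cexp 0 = cone.
Proof. by apply: circle_eq; rewrite /re /im /= ?cos0 ?sin0. Qed.

Lemma cexpN (t : R) : cexp (- t) = cinv (cexp t).
Proof. by apply: circle_eq; rewrite /re /im /= ?cosN ?sinN. Qed.

Lemma sqr_le1_itv (x : R) : x ^+ 2 <= 1 -> -1 <= x <= 1.
Proof. by move=> h; rewrite -ler_norml -(@expr_le1 _ 2)// real_normK// num_real. Qed.

Lemma im_itv (a : S1) : -1 <= im a <= 1.
Proof. by apply: sqr_le1_itv; rewrite -(re_im a) lerDr sqr_ge0. Qed.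

Lemma re_itv (a : S1) : -1 <= re a <= 1.
Proof. by apply: sqr_le1_itv; rewrite -(re_im a) lerDl sqr_ge0. Qed.

(** The arccosine of the real part is the angle up to sign, and the sign of the imaginary part
    decides. *)
Lemma cexp_surj (a : S1) : exists t, cexp t = a.
Proof.
have sE : sin (acos (re a)) = `|im a|.
  by rewrite sin_acos ?re_itv// -sqrtr_sqr; congr Num.sqrt; rewrite -(re_im a); ring.
have cE : cos (acos (re a)) = re a by rewrite acosK// in_itv /= re_itv.
have [i0|i0] := leP 0 (im a).
  by exists (acos (re a)); apply: circle_eq; [exact: cE|rewrite -[RHS]ger0_norm].
exists (- acos (re a)); apply: circle_eq; first by rewrite -[RHS]cE; exact: cosN.
by rewrite -[RHS]opprK -(ltr0_norm i0) -sE; exact: sinN.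
Qed.

(** The angle between -pi/2 and pi/2. It is the true argument when [0 < re a]; on the left half of
    the circle it is the angle of the mirror image in the imaginary axis. *)
Definition carg (a : S1) : R := asin (im a).

Lemma cargK (a : S1) : 0 < re a -> cexp (carg a) = a.
Proof.
move=> a0; apply: circle_eq; last first.
  by apply: asinK; rewrite in_itv /= im_itv.
rewrite -[RHS]gtr0_norm// -sqrtr_sqr (_ : _ ^+ 2 = 1 - im a ^+ 2).
  exact/cos_asin/im_itv.
by rewrite -(re_im a) addrK.
Qed.

(** A positive real part keeps the imaginary part strictly between -1 and 1, where [asin] is
    continuous. *)
Lemma carg_continuous (Z : topologicalType) (f : Z -> S1) :
  continuous f -> (forall z, 0 < re (f z)) -> continuous (fun z => carg (f z)).
Proof.
move=> cf f0 z; apply: (@continuous_comp _ R R (fun z => im (f z)) (@asin R) z).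
  by apply: comp_continuous => //; exact: im_continuous.
apply: (@continuous_asin _ (im (f z))).
rewrite -ltr_norml -(@expr_lt1 _ 2)// real_normK ?num_real//.
by rewrite -(re_im (f z)) ltrDr exprn_gt0.
Qed.

Lemma cexp_pi2n (k : int) : cexp (k%:~R * (pi *+ 2)) = cone.
Proof.
have h (n : nat) : cexp (n%:R * (pi *+ 2)) = cone.
  elim: n => [|n IH]; first by rewrite mul0r cexp0.
  rewrite -addn1 natrD mulrDl mul1r cexpD IH cmul1.
  by apply: circle_eq; rewrite /re /im /= ?cos2pi ?sin2pi.
case: k => n; first exact: h.
rewrite NegzE mulrNz mulNr cexpN h; apply: circle_eq => //.
by rewrite /im /= oppr0.
Qed.

Lemma cexp_eq1 (t : R) : cexp t = cone -> exists k : int, t = k%:~R * (pi *+ 2).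
Proof.
have p0 : 0 < (pi : R) *+ 2 by rewrite mulrn_wgt0// pi_gt0.
move=> te; exists (Num.floor (t / (pi *+ 2))).
set k := Num.floor _.
have /andP[k1 k2] : k%:~R <= t / (pi *+ 2) < (k + 1)%:~R by apply: floor_itv; exact: num_real.
pose r := t - k%:~R * (pi *+ 2).
have r0 : 0 <= r by rewrite subr_ge0 -ler_pdivlMr.
have r1 : r < pi *+ 2.
  rewrite ltrBlDr -[X in X + _]mul1r -mulrDl -ltr_pdivrMr// addrC.
  by move: k2; rewrite intrD.
have cr : cos r = 1.
  have : cexp r = cone by rewrite /r cexpD -mulNr -mulrNz cexp_pi2n te cmul1.
  by move/(congr1 re).
apply/eqP; rewrite -subr_eq0 -/r; apply/eqP/le_anti; rewrite r0 andbT leNgt.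
apply/negP => rp.
(* If 0 < r < 2 pi, then r / 2 lies strictly between 0 and pi, so its sine is positive; the double
   angle formula turns cos r = 1 into sin (r / 2) = 0. *)
have : 0 < sin (r / 2).
  by apply: sin_gt0_pi; apply/andP; split; [lra|rewrite ltr_pdivrMr// mulr_natr].
have rE : r / 2 *+ 2 = r by rewrite -mulr_natr divfK// pnatr_eq0.
have := cos_mulr2n (r / 2); rewrite rE cr.
have := cos2Dsin2 (r / 2); move: (cos _) (sin _) => x y; nra.
Qed.

Lemma cexp_eq (s t : R) : cexp s = cexp t ->
  exists k : int, t = s + k%:~R * (pi *+ 2).
Proof.
move=> e; have [|k tk] := @cexp_eq1 (t - s).
  by rewrite cexpD cexpN -e cmulC cmulV.
by exists k; rewrite -tk addrC subrK.
Qed.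

Local Notation I := (unit_interval R).

(** On the diagonal the quotient is 1, whose real part is positive, and positivity is an open
    condition. *)
Lemma mul_cinv_diag (Z : topologicalType) (g : Z -> S1) (x : Z) :
  continuous g ->
  \forall w \near x & y \near x, 0 < re (cmul (g w) (cinv (g y))).
Proof.
move=> cg.
have cc : continuous (fun p : Z * Z => re (cmul (g p.1) (cinv (g p.2)))).
  apply: comp_continuous; first exact: re_continuous.
  apply: cmul_continuous.
    by apply: comp_continuous; [exact: cg|exact: fst_continuous].
  apply: comp_continuous; first exact: cinv_continuous.
  by apply: comp_continuous; [exact: cg|exact: snd_continuous].
have e : re (cmul (g x) (cinv (g x))) = 1 by rewrite cmulC cmulV.
apply: (cc (x, x) [set r : R | 0 < r]); apply: open_nbhs_nbhs.
by split; [exact: open_gt|rewrite /= e ltr01].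
Qed.

(** Compactness of the unit square makes the radius of the preceding lemma uniform. The positive
    real part is the condition under which [carg] inverts [cexp]. *)
Lemma circle_uniform (g : R * R -> S1) : continuous g ->
  exists2 d : R, 0 < d & forall x w : R * R,
    0 <= x.1 <= 1 -> 0 <= x.2 <= 1 -> ball x d w ->
    0 < re (cmul (g w) (cinv (g x))).
Proof.
move=> cg.
have cK : compact (`[(0 : R), 1] `*` `[(0 : R), 1]).
  by apply: compact_setX; exact: segment_compact.
pose P (d : R) (x : R * R) := forall w, ball x d w -> 0 < re (cmul (g w) (cinv (g x))).
have : \forall d \near 0^'+, (`[(0 : R), 1] `*` `[(0 : R), 1]) `<=` P d.
  move/compact_near_coveringP : cK; apply => x _.
  have [[U V] [/= /nbhs_ballP[e /= e0 eU] xV] UV] := mul_cinv_diag x cg.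
  near=> y d.
  (* Half of the radius [e], because [w] is compared with [x] through the nearby point [y]. *)
  have de : d <= e / 2 by near: d; apply: nbhs_right_le; rewrite divr_gt0.
  move=> w yw; apply: (UV (w, y)); split => /=; last by near: y.
  apply: eU; apply: (@ball_split _ _ y); last first.
  - exact: le_ball yw.
  - by near: y; apply: nbhsx_ballx; rewrite divr_gt0.
move=> h; have [d [d0 dP]] : exists d : R, 0 < d /\ (`[(0 : R), 1] `*` `[(0 : R), 1]) `<=` P d.
  apply: (@filter_ex _ (0^'+)); near=> d; split; last by near: d.
  by near: d; exact: nbhs_right_gt.
by exists d => // x w x1 x2; apply: dP; split; rewrite /= in_itv.
Unshelve. all: by end_near. Qed.

End Circle.

(** * Lifting through the exponential; winding numbers and pi_1 of the circle *)

Section Winding.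
Variable R : realType.
Local Notation I := (unit_interval R).
Local Notation S1 := (circle R).

(* Uniform continuity makes consecutive values along the ray from the origin to
   z close, so the angle at z is that of the origin plus the sum of the arguments
   of the successive quotients g (a k.+1 z) / g (a k z). *)
Lemma circle_lift2 (f : I * I -> S1) : continuous f ->
  exists2 th : I * I -> R, continuous th & forall z, cexp (th z) = f z.
Proof.
move=> cf.
(* Clamping the coordinates extends [f] to the whole plane, where balls and scalings are
   available. *)
pose g (w : R * R) := f (iproj w.1, iproj w.2).
have cg : continuous g.
  apply: (comp_continuous (f := f)) => //; apply: pair_continuous.
    by apply: iproj_comp_continuous; exact: fst_continuous.
  by apply: iproj_comp_continuous; exact: snd_continuous.
have [d d0 dP] := circle_uniform cg.
pose N := (Num.truncn d^-1).+1.
have Nd : N%:R^-1 < d.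
  by rewrite invf_plt ?posrE ?ltr0Sn// /N truncnS_gt.
have N0 : 0 < N%:R :> R by rewrite ltr0Sn.
pose a k (z : I * I) : R * R := (k%:R / N%:R * ival z.1, k%:R / N%:R * ival z.2).
have ca k : continuous (a k).
  apply: pair_continuous; apply: mulr_continuous; apply: comp_continuous;
    (try exact: ival_continuous); [exact: fst_continuous|exact: snd_continuous].
pose q k z := cmul (g (a k.+1 z)) (cinv (g (a k z))).
have cq k : continuous (q k).
  apply: cmul_continuous; first by apply: comp_continuous.
  apply: comp_continuous; first exact: cinv_continuous.
  exact: comp_continuous.
have q0 k z : (k < N)%N -> 0 < re (q k z).
  move=> kN; have kN1 : 0 <= (k%:R / N%:R : R) <= 1.
    by rewrite divr_ge0//= ler_pdivrMr// mul1r ler_nat ltnW.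
  have aux (t : I) : 0 <= k%:R / N%:R * ival t <= 1.
    case/andP: kN1 => k0 k1; rewrite mulr_ge0 ?ival_ge0//=.
    by rewrite mulr_ile1 ?ival_ge0 ?ival_le1.
  have aux2 (t : I) : ball (k%:R / N%:R * ival t) d (k.+1%:R / N%:R * ival t).
    rewrite /ball /= -mulrBl -mulrBl -natr1 opprD addrA subrr add0r mulN1r.
    rewrite mulNr normrN ger0_norm; last by rewrite mulr_ge0 ?ival_ge0// invr_ge0 ltW.
    by rewrite (le_lt_trans _ Nd)// ger_pMr ?invr_gt0// ival_le1.
  by apply: dP; [exact: aux|exact: aux|split; exact: aux2].
have [t0 t0E] := cexp_surj (g (0, 0)).
have lift m : (m <= N)%N -> exists2 th : I * I -> R,
    continuous th & forall z, cexp (th z) = g (a m z).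
  elim: m => [|m IH] mN.
    exists (fun=> t0) => [z|z]; first exact: cvg_cst.
    by rewrite t0E /a !mul0r.
  have [th cth thE] := IH (ltnW mN).
  exists (fun z => th z + carg (q m z)) => [|z].
    apply: real_continuousD => //; apply: carg_continuous => // z; exact: q0.
  by rewrite cexpD cargK ?q0// thE cmulC -cmulA cmulV cmulC cmul1.
have [th cth thE] := lift N (leqnn N); exists th => // z.
by rewrite thE /g /a /= divff ?gt_eqF// !mul1r !ivalK -surjective_pairing.
Qed.

Lemma circle_lift (f : I -> S1) : continuous f ->
  exists2 th : I -> R, continuous th & forall t, cexp (th t) = f t.
Proof.
move=> cf; have [|th cth thE] := @circle_lift2 (fun z => f z.1).
  by apply: comp_continuous => //; exact: fst_continuous.
exists (fun t => th (t, zero)) => [|t]; last by rewrite thE.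
apply: comp_continuous => //; apply: pair_continuous => t; first exact: cvg_id.
exact: cst_continuous.
Qed.

(** By the intermediate value theorem, a function that ends above its start would pass halfway
    between two consecutive multiples; the opposite case follows by negation. It is applied to
    differences of lifts, with c = 2 pi. *)
Lemma continuous_multiple_cst (c : R) (d : I -> R) : 0 < c -> continuous d ->
  (forall t, exists k : int, d t = k%:~R * c) -> d zero = d one.
Proof.
move=> c0.
suff h (e : I -> R) : continuous e -> (forall t, exists k : int, e t = k%:~R * c) ->
    e one <= e zero.
  move=> cd dk; apply/le_anti/andP; split; last exact: h.
  rewrite -lerN2; apply: (h (fun t => - d t)) => [t|t].
    by apply: (@continuousN R R^o); exact: cd.
  by have [k ->] := dk t; exists (- k); rewrite mulrNz mulNr.
move=> ce ek; rewrite leNgt; apply/negP => e01.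
have [k kE] := ek zero; have [l lE] := ek one.
have kl : (k + 1 <= l).
  by rewrite lezD1 -(ltr_int R) -(ltr_pM2r c0) -kE -lE.
have [|||x _ xE] := @IVT R (fun r => e (iproj r)) 0 1 ((k%:~R + 2^-1) * c).
- exact: ler01.
- by apply: continuous_subspaceT; apply: comp_iproj_continuous => // r; exact: cvg_id.
- have -> : e (iproj 0) = k%:~R * c by [].
  have -> : e (iproj 1) = l%:~R * c by [].
  have kcl : k%:~R * c <= l%:~R * c by rewrite -kE -lE ltW.
  rewrite min_l// max_r// !ler_pM2r//; apply/andP; split; first lra.
  by have : (k + 1)%:~R <= l%:~R :> R; [rewrite ler_int|rewrite intrD; lra].
have [m mE] := ek (iproj x).
move: xE; rewrite mE => /(mulIf (lt0r_neq0 c0)) mk.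
have : k%:~R < m%:~R :> R by rewrite mk; lra.
have : m%:~R < (k + 1)%:~R :> R by rewrite mk intrD; lra.
by rewrite !ltr_int ltzD1 leNgt => /negPf ->.
Qed.

Lemma pi2_gt0 : 0 < (pi : R) *+ 2.
Proof. by rewrite mulrn_wgt0// pi_gt0. Qed.

(** A relation rather than a function, because a lift is determined only up to a multiple of 2 pi;
    uniqueness of [k] is proved separately. *)
Definition winding (f : I -> S1) (k : int) : Prop :=
  exists th : I -> R, [/\ continuous th, forall t, cexp (th t) = f t &
    th one = th zero + k%:~R * (pi *+ 2)].

Lemma winding_ex (x : S1) (p : {path I from x to x in S1}) :
  exists k, winding p k.
Proof.
have [|th cth thE] := @circle_lift p; first exact: cts_fun.
have [|k kE] := @cexp_eq _ (th zero) (th one).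
  by rewrite !thE (@path_zero _ _ _ _ p) (@path_one _ _ _ _ p).
by exists k, th.
Qed.

(** The difference of two lifts takes values in the multiples of 2 pi, hence is the same at both
    ends. *)
Lemma winding_inj (f : I -> S1) k l : winding f k -> winding f l -> k = l.
Proof.
move=> [th [cth thE thk]] [ph [cph phE phl]].
have := @continuous_multiple_cst _ (fun t => ph t - th t) pi2_gt0.
rewrite thk phl => /(_ (real_continuousB cph cth)) h.
have {h} : ph zero - th zero =
    ph zero + l%:~R * (pi *+ 2) - (th zero + k%:~R * (pi *+ 2)).
  apply: h => t; have [|m ->] := @cexp_eq _ (th t) (ph t); first by rewrite thE phE.
  by exists m; rewrite addrC addKr.
move=> h; have : k%:~R * (pi *+ 2) = l%:~R * (pi *+ 2) :> R by lra.
by move/(mulIf (lt0r_neq0 pi2_gt0))/intr_inj.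
Qed.

(* The winding number of the slices of a homotopy is continuous and takes values
   in a discrete set. *)
Lemma winding_homotopic (x : S1) (p q : {path I from x to x in S1}) k :
  path_homotopic p q -> winding p k -> winding q k.
Proof.
move=> [H [cH H0 H1 Hx Hy]] pk.
have [th cth thE] := circle_lift2 cH.
have cths s : continuous (fun t => th (t, s)).
  apply: comp_continuous => //; apply: pair_continuous => t; first exact: cvg_id.
  exact: cst_continuous.
have ctht t : continuous (fun s => th (t, s)).
  apply: comp_continuous => //; apply: pair_continuous => s; last exact: cvg_id.
  exact: cst_continuous.
have ends s : exists k : int, th (one, s) = th (zero, s) + k%:~R * (pi *+ 2).
  by apply: cexp_eq; rewrite !thE Hx Hy.
have := @continuous_multiple_cst _ (fun s => th (one, s) - th (zero, s)) pi2_gt0.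
move=> /(_ (real_continuousB (ctht _) (ctht _))) h.
have {h} th01 : th (one, zero) - th (zero, zero) = th (one, one) - th (zero, one).
  by apply: h => s; have [m ->] := ends s; exists m; rewrite addrC addKr.
have [l lE] := ends zero.
have -> : k = l.
  apply: (winding_inj pk); exists (fun t => th (t, zero)).
  by split => // t; rewrite thE H0.
exists (fun t => th (t, one)); split => // [t|]; first by rewrite thE H1.
by move: th01; rewrite lE; lra.
Qed.

Lemma winding_cat (x : S1) (p q : {path I from x to x in S1}) k l :
  winding p k -> winding q l -> winding (path_cat p q) (k + l).
Proof.
move=> [th [cth thE thk]] [ph [cph phE phl]].
(* The two lifts need not agree at the junction, but they differ there by a multiple of 2 pi, which
   is added to the second one. *)
have [|m mE] := @cexp_eq _ (ph zero) (th one).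
  by rewrite thE phE (@path_zero _ _ _ _ q) (@path_one _ _ _ _ p).
exists (fun t => if ival t <= 2^-1 then th (iproj (2 * ival t))
          else ph (iproj (2 * ival t - 1)) + m%:~R * (pi *+ 2)); split.
- have ci := @ival_continuous R.
  apply: (@pasting R I R (@ival R) 2^-1 (fun t => th (iproj (2 * ival t)))
    (fun t => ph (iproj (2 * ival t - 1)) + m%:~R * (pi *+ 2))) => //.
  + by apply: comp_iproj_continuous => //; exact: mulr_continuous.
  + apply: addr_continuous; apply: comp_iproj_continuous => //.
    exact: mul2B1_continuous.
  + by move=> t ->; rewrite divff ?pnatr_eq0// subrr.
- move=> t; rewrite /= /mk_path /path_cat_fun; case: ifP => _; first exact: thE.
  by rewrite cexpD cexp_pi2n cmulC cmul1.
- rewrite ival_one ival_zero ifF; last by apply/negbTE; rewrite -ltNge; lra.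
  rewrite ifT ?invr_ge0// mulr0 mulr1 (_ : 2 - 1 = 1); last by lra.
  rewrite -/one -/zero.
  rewrite phl addrAC -mE thk intrD mulrDl addrA //.
Qed.

(** After a shift the two lifts start at the same angle; equal winding numbers make them end at the
    same angle, so the straight-line homotopy between them fixes both ends. *)
Lemma winding_eq_homotopic (x : S1) (p q : {path I from x to x in S1}) k :
  winding p k -> winding q k -> path_homotopic p q.
Proof.
move=> [th [cth thE thk]] [ph [cph phE phk]].
have [|m mE] := @cexp_eq _ (ph zero) (th zero).
  by rewrite thE phE (@path_zero _ _ _ _ q) (@path_zero _ _ _ _ p).
pose ps t := ph t + m%:~R * (pi *+ 2).
have psE t : cexp (ps t) = q t by rewrite cexpD cexp_pi2n cmulC cmul1.
exists (fun z => cexp ((1 - ival z.2) * th z.1 + ival z.2 * ps z.1)).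
split => [|t|t|s|s] /=.
- apply: comp_continuous; first exact: cexp_continuous.
  apply: (@conv_continuous R (I * I)%type (fun z => ival z.2) (fun z => th z.1)
    (fun z => ps z.1)).
  + by apply: comp_continuous; [exact: ival_continuous|exact: snd_continuous].
  + by apply: comp_continuous => //; exact: fst_continuous.
  + apply: addr_continuous.
    by apply: comp_continuous => //; exact: fst_continuous.
- by rewrite ival_zero subr0 mul0r mul1r addr0.
- by rewrite ival_one subrr mul0r mul1r add0r.
- rewrite /ps -mE -mulrDl subrK mul1r thE; exact: (@path_zero _ _ _ _ p).
- rewrite /ps phk addrAC -mE -thk -mulrDl subrK mul1r thE.
  exact: (@path_one _ _ _ _ p).
Qed.

Lemma winding_surj (x : S1) (k : int) :
  exists p : {path I from x to x in S1}, winding p k.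
Proof.
have [a aE] := cexp_surj x.
pose th (t : I) : R := k%:~R * (pi *+ 2) * ival t + a.
have cth : continuous th.
  by apply: addr_continuous; apply: mulr_continuous; exact: ival_continuous.
have cp : continuous (fun t => cexp (th t)).
  by apply: comp_continuous => //; exact: cexp_continuous.
have p0 : cexp (th zero) = x by rewrite /th ival_zero mulr0 add0r.
have p1 : cexp (th one) = x by rewrite /th ival_one mulr1 cexpD cexp_pi2n cmul1.
exists (mk_path cp p0 p1), th; split => //.
by rewrite /th ival_zero ival_one mulr0 mulr1 add0r addrC.
Qed.

(** Stated at an arbitrary base point, so that the torus factor never has to be moved. *)
Lemma pi1_circle (x : S1) : exists2 deg : pi1 R x -> int, bijective deg &
  forall a b, deg (a * b)%g = deg a + deg b.
Proof.
have /choice[deg degP] : forall a : pi1 R x, exists k, winding (repr a) k.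
  by move=> a; exact: winding_ex.
have degE (p : {path I from x to x in S1}) : winding p (deg (\pi_(pi1 R x) p)).
  exact: winding_homotopic (pi1_repr p) (degP _).
exists deg => [|a b].
  apply: inj_surj_bij => [a b ab|k].
    elim/quotW: a ab => p; elim/quotW: b => q pq.
    apply/pi1P; apply: (winding_eq_homotopic (degE p)).
    by rewrite pq.
  have [p pk] := winding_surj x k; exists (\pi_(pi1 R x) p).
  exact: winding_inj (degE p) pk.
elim/quotW: a => p; elim/quotW: b => q; rewrite pi1_mulgE.
exact: winding_inj (degE _) (winding_cat (degE p) (degE q)).
Qed.

End Winding.

(** * Path connectedness of the torus minus a finite set *)

Section Joined.
Variables (R : realType) (X : topologicalType).
Local Notation I := (unit_interval R).

(** The path lives in the ambient space and [A] only constrains its values, so no subspace topology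
    is involved; [setT] gives plain path connectedness. *)
Definition joined_in (A : set X) (x y : X) : Prop :=
  exists2 p : {path I from x to y in X}, True & forall t, A (p t).

Lemma joined_in_trans (A : set X) (x y z : X) :
  joined_in A x y -> joined_in A y z -> joined_in A x z.
Proof.
move=> [p _ Ap] [q _ Aq]; exists (path_cat p q) => // t.
by rewrite /= /mk_path /path_cat_fun; case: ifP.
Qed.

Lemma joined_in_sym (A : set X) (x y : X) :
  joined_in A x y -> joined_in A y x.
Proof. by move=> [p _ Ap]; exists (path_rev p) => // t; exact: Ap. Qed.

Lemma joined_in_fun (A : set X) (f : I -> X) : continuous f ->
  (forall t, A (f t)) -> joined_in A (f zero) (f one).
Proof. by move=> cf Af; exists (mk_path cf erefl erefl). Qed.

End Joined.
Arguments joined_in_fun {R X A f}.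

Section TorusMinusFinite.
Variable R : realType.
Local Notation I := (unit_interval R).
Local Notation S1 := (circle R).
Local Notation T := (torus R).

(** The interval excludes 0 and includes 2 pi: seen from a starting point, that point itself is met
    only after a full turn. *)
Lemma cexp_surj_pos (a : S1) : exists2 t, 0 < t <= pi *+ 2 & cexp t = a.
Proof.
have [s sE] := cexp_surj a; have p0 := pi2_gt0 R.
set k := Num.ceil (s / (pi *+ 2)).
have /andP[k1 k2] : (k - 1)%:~R < s / (pi *+ 2) <= k%:~R.
  by apply: ceil_itv; exact: num_real.
exists (s + (- (k - 1))%:~R * (pi *+ 2)).
  rewrite mulrNz mulNr subr_gt0 -ltr_pdivlMr// k1/= lerBlDr.
  rewrite -[X in X + _]mul1r -mulrDl -ler_pdivrMr//.
  by rewrite intrB addrC subrK.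
by rewrite cexpD cexp_pi2n cmulC cmul1.
Qed.

Lemma cexp_inj_itv (s t : R) : `|s - t| < pi *+ 2 -> cexp s = cexp t -> s = t.
Proof.
move=> + /cexp_eq[k kE]; rewrite kE opprD addrA subrr sub0r normrN normrM.
rewrite (gtr0_norm (pi2_gt0 R)) -[ltRHS]mul1r (ltr_pM2r (pi2_gt0 R)).
rewrite -intr_norm (ltr_int R _ 1) -[ltRHS]add0r ltzD1 normr_le0 => /eqP ->.
by rewrite mul0r addr0.
Qed.

(** Each point of [F] is first met at some angle in ]0, 2 pi]; the smallest of these angles bounds a
    free arc. The starting point [a] may itself belong to [F]. *)
Lemma circle_arc (F : seq S1) (a : S1) : exists2 e, 0 < e <= pi *+ 2 &
  forall t, 0 < t < e -> cmul a (cexp t) \notin F.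
Proof.
elim: F => [|f F [e /andP[e0 e1] eF]].
  by exists (pi *+ 2); rewrite ?pi2_gt0 ?lexx.
have [s /andP[s0 s1] sE] := cexp_surj_pos (cmul (cinv a) f).
exists (Num.min e s); first by rewrite lt_min e0 s0 ge_min e1.
move=> t /andP[t0]; rewrite lt_min => /andP[te ts].
rewrite inE negb_or eF ?t0// andbT; apply/eqP => af.
have st : s = t by apply: cexp_inj_itv; rewrite ?sE -?af ?cmulK// ltr_norml; lra.
by rewrite st ltxx in ts.
Qed.

Lemma circle_notin (F : seq S1) : exists u, u \notin F.
Proof.
have [e /andP[e0 _] eF] := circle_arc F (cone R).
by exists (cmul (cone R) (cexp (e / 2))); apply: eF; lra.
Qed.

Definition compl (F : seq T) : set T := [set z | z \notin F].

(** The whole vertical circle over [u] misses [F], so any rotation along it is allowed. *)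
Lemma joined_vertical (F : seq T) (u v w : S1) : u \notin map fst F ->
  joined_in R (compl F) (u, v) (u, w).
Proof.
move=> uF; have [s sE] := cexp_surj (cmul (cinv v) w).
pose f (t : I) : T := (u, cmul v (cexp (s * ival t))).
have -> : (u, v) = f zero.
  by rewrite /f ival_zero mulr0 cexp0 cmulC cmul1.
have -> : (u, w) = f one by rewrite /f ival_one mulr1 sE cmulVK.
apply: joined_in_fun => [|t].
  apply: pair_continuous; first exact: cst_continuous.
  apply: cmul_continuous; first exact: cst_continuous.
  apply: comp_continuous; first exact: cexp_continuous.
  by apply: mulr_continuous; exact: ival_continuous.
by apply: contra uF => /(map_f fst).
Qed.

Lemma joined_horizontal (F : seq T) (u w v : S1) : v \notin map snd F ->
  joined_in R (compl F) (u, v) (w, v).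
Proof.
move=> vF; have [s sE] := cexp_surj (cmul (cinv u) w).
pose f (t : I) : T := (cmul u (cexp (s * ival t)), v).
have -> : (u, v) = f zero.
  by rewrite /f ival_zero mulr0 cexp0 cmulC cmul1.
have -> : (w, v) = f one by rewrite /f ival_one mulr1 sE cmulVK.
apply: joined_in_fun => [|t].
  apply: pair_continuous; last exact: cst_continuous.
  apply: cmul_continuous; first exact: cst_continuous.
  apply: comp_continuous; first exact: cexp_continuous.
  by apply: mulr_continuous; exact: ival_continuous.
by apply: contra vF => /(map_f snd).
Qed.

(* A short horizontal arc leaves every vertical circle that meets F. *)
Lemma joined_generic (F : seq T) (a : T) : a \notin F ->
  exists2 u, u \notin map fst F & joined_in R (compl F) a (u, a.2).
Proof.
move=> aF; have [e /andP[e0 _] eF] := circle_arc (map fst F) a.1.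
pose f (t : I) : T := (cmul a.1 (cexp (e / 2 * ival t)), a.2).
exists (f one).1; first by rewrite /f ival_one mulr1; apply: eF; lra.
have f0 : f zero = a.
  by rewrite /f ival_zero mulr0 cexp0 cmulC cmul1 -surjective_pairing.
rewrite -{1}f0; apply: joined_in_fun => [|t].
  apply: pair_continuous; last exact: cst_continuous.
  apply: cmul_continuous; first exact: cst_continuous.
  apply: comp_continuous; first exact: cexp_continuous.
  by apply: mulr_continuous; exact: ival_continuous.
have := ival_ge0 t; rewrite le_eqVlt => /predU1P[t0|t0].
  by rewrite /compl /= /f -t0 mulr0 cexp0 cmulC cmul1 -surjective_pairing.
have : (f t).1 \notin map fst F.
  apply: eF; rewrite mulr_gt0//= ?divr_gt0//.
  by rewrite (le_lt_trans (ler_piMr _ (ival_le1 t)))//; lra.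
by apply: contra => /(map_f fst).
Qed.

(** Each point is brought to a vertical circle missing [F] and then to one common horizontal circle
    missing [F], along which the two ends meet. *)
Lemma torus_joined (F : seq T) (a b : T) : a \notin F -> b \notin F ->
  joined_in R (compl F) a b.
Proof.
move=> aF bF; have [v vF] := circle_notin (map snd F).
have join c : c \notin F -> exists u, joined_in R (compl F) c (u, v).
  move=> /joined_generic[u uF cu]; exists u; apply: joined_in_trans cu _.
  exact: joined_vertical.
have [u au] := join a aF; have [w bw] := join b bF.
apply: joined_in_trans au (joined_in_trans _ (joined_in_sym bw)).
exact: joined_horizontal.
Qed.

End TorusMinusFinite.

(** * Configuration spaces, and connectedness over the punctured torus *)

Section ConfigurationTopology.
Variables (X : topologicalType) (n : nat).
Implicit Types x y : configuration X n.

Lemma configurationP x : injective (point_of x).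
Proof. exact: (set_valP x). Qed.

Definition Configuration (f : 'I_n -> X) (fI : injective f) : configuration X n :=
  exist _ (f : prod_topology _) (mem_set fI).

Lemma configuration_eq x y : point_of x =1 point_of y -> x = y.
Proof. by move=> xy; apply: val_inj; apply/funext => i; exact: xy. Qed.

Lemma point_of_continuous i : continuous (fun x => point_of x i).
Proof.
move=> x; apply: (@continuous_comp _ (prod_topology (fun=> X)) X set_val (proj i)).
  exact: initial_continuous.
exact: proj_continuous.
Qed.

Lemma configuration_continuous (Z : topologicalType)
    (f : Z -> configuration X n) :
  (forall i, continuous (fun z => point_of (f z) i)) -> continuous f.
Proof.
move=> cf; apply: subtype_continuous => z; apply/cvg_sup => i.
move: z; apply/(@continuousP _ (initial_topology (@^~ i))) => _ [B oB <-].
by move/continuousP: (cf i) => /(_ B oB).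
Qed.

End ConfigurationTopology.

Section PuncturedConfiguration.
Variables (R : realType) (o : torus R) (n : nat).
Local Notation I := (unit_interval R).
Local Notation T := (torus R).
Local Notation X := (punctured_torus o).
Implicit Types x y z : configuration X n.

Definition tpoint x (i : 'I_n) : T := set_val (point_of x i).

Lemma tpoint_neq x i : tpoint x i != o.
Proof. by apply/eqP; exact: (set_valP (point_of x i)). Qed.

Lemma tpoint_inj x : injective (tpoint x).
Proof. by move=> i j ij; apply: (@configurationP _ _ x); exact: val_inj ij. Qed.

Definition puncture (a : T) (ao : a != o) : X :=
  exist (fun b : T => b \in [set~ o]) a (mem_set (elimN eqP ao)).

Lemma configuration_of (f : 'I_n -> T) : injective f -> (forall i, f i != o) ->
  exists x, forall i, tpoint x i = f i.
Proof.
move=> fI fo.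
have gI : injective (fun i => puncture (fo i)) by move=> i j /(congr1 set_val)/fI.
by exists (Configuration gI).
Qed.

(** The moving point travels in the torus minus the puncture and the other, fixed points, which is
    path connected. *)
Lemma joined_coordinate x y (i : 'I_n) :
  (forall j, j != i -> tpoint x j = tpoint y j) -> joined_in R setT x y.
Proof.
move=> xy; pose F := o :: [seq tpoint x j | j <- enum 'I_n & j != i].
have xF j : j != i -> tpoint x j \in F.
  by move=> ji; rewrite inE map_f ?orbT// mem_filter ji mem_enum.
have [p _ pF] : joined_in R (compl F) (tpoint x i) (tpoint y i).
  apply: torus_joined; rewrite inE negb_or tpoint_neq /=;
    apply/mapP => -[j]; rewrite mem_filter => /andP[ji _]; last rewrite (xy j)//;
    by move=> ij; rewrite (tpoint_inj ij) eqxx in ji.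
have po t : p t != o by have := pF t; rewrite /compl /= inE negb_or => /andP[].
pose g t j : X := if j == i then puncture (po t) else point_of x j.
have gI t : injective (g t).
  move=> j k /(congr1 set_val); rewrite /g.
  case: (eqVneq j i) => [->|ji]; case: (eqVneq k i) => [->|ki] //.
  - by move=> pk; have := pF t; rewrite /compl /= [p t]pk xF.
  - by move=> /esym pj; have := pF t; rewrite /compl /= [p t]pj xF.
  - exact: tpoint_inj.
pose f t := Configuration (gI t).
have -> : x = f zero.
  apply: configuration_eq => j; apply: val_inj.
  rewrite -[RHS]/(set_val (g zero j)) /g.
  by case: (eqVneq j i) => // ->; rewrite /set_val /= (@path_zero _ _ _ _ p).
have -> : y = f one.
  apply: configuration_eq => j; apply: val_inj.
  rewrite -[RHS]/(set_val (g one j)) /g.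
  case: (eqVneq j i) => [->|ji]; first by rewrite /set_val /=;
    rewrite (@path_one _ _ _ _ p).
  by rewrite -[RHS]/(tpoint x j) xy.
apply: joined_in_fun => // ; apply: configuration_continuous => j.
rewrite (_ : (fun t => _) = g ^~ j)// /g.
case: (eqVneq j i) => _; last exact: cst_continuous.
by apply: subtype_continuous; exact: cts_fun.
Qed.

(* The points are moved one at a time; disjointness keeps the intermediate
   configurations injective. *)
Lemma joined_disjoint x y : (forall i j, tpoint x i != tpoint y j) ->
  joined_in R setT x y.
Proof.
move=> xy.
have zE k : exists z, forall i : 'I_n,
    tpoint z i = if (i < k)%N then tpoint y i else tpoint x i.
  apply: configuration_of => [i j|i]; last by case: ifP; rewrite tpoint_neq.
  case: ifP => _; case: ifP => _; try exact: tpoint_inj.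
    by move=> /esym/eqP; rewrite (negPf (xy _ _)).
  by move=> /eqP; rewrite (negPf (xy _ _)).
suff h k : (k <= n)%N -> forall z, (forall i : 'I_n,
    tpoint z i = if (i < k)%N then tpoint y i else tpoint x i) -> joined_in R setT x z.
  by apply: (h n) => // i; rewrite ltn_ord.
elim: k => [_ z zx|k IH kn z zk].
  rewrite (_ : z = x).
    by exists (path_cst R x).
  by apply: configuration_eq => i; apply: val_inj; exact: zx.
have [w wk] := zE k; apply: (joined_in_trans (IH (ltnW kn) w wk)).
apply: (@joined_coordinate _ _ (Ordinal kn)) => j jk.
by rewrite wk zk ltnS [(j <= k)%N]leq_eqVlt -[_ == k]/(j == Ordinal kn) (negPf jk).
Qed.

(** Two configurations may share points, which blocks a direct move. Both are therefore joined to a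
    third one, placed on a short arc that avoids the puncture and all the points of either. *)
Lemma configuration_joined x y : joined_in R setT x y.
Proof.
pose F := o :: [seq tpoint x j | j <- enum 'I_n] ++ [seq tpoint y j | j <- enum 'I_n].
have [e /andP[e0 e1] eF] := circle_arc (map fst F) (cone R).
(* Numerator i + 1 and denominator n + 1 keep the equally spaced angles strictly between 0 and
   [e]. *)
pose s (i : 'I_n) : R := e * (i.+1%:R / n.+1%:R).
have sI (i : 'I_n) : 0 < s i < e.
  rewrite mulr_gt0 ?divr_gt0//= gtr_pMr// ltr_pdivrMr// mul1r ltr_nat ltnS.
  exact: ltn_ord.
pose f i : T := (cmul (cone R) (cexp (s i)), cone R).
have fF i : f i \notin F by have := eF _ (sI i); apply: contra => /(map_f fst).
have fI : injective f.
  move=> i j /(congr1 fst)/(congr1 (cmul (cinv (cone R)))); rewrite !cmulK => /cexp_inj_itv h.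
  have /mulfI : s i = s j.
    have /andP[? ?] := sI i; have /andP[? ?] := sI j.
    by apply: h; rewrite ltr_norml; lra.
  move=> /(_ (lt0r_neq0 e0)) /mulIf; rewrite invr_eq0 pnatr_eq0 => /(_ isT) /eqP.
  by rewrite eqr_nat => /eqP [/val_inj].
have [|w wE] := configuration_of fI.
  by move=> i; have := fF i; rewrite inE negb_or => /andP[].
apply: (@joined_in_trans _ _ _ _ w); last apply: joined_in_sym;
  apply: joined_disjoint => i j; rewrite wE; have := fF j;
  apply: contra => /eqP <-; rewrite inE mem_cat !map_f ?mem_enum ?orbT//.
Qed.

End PuncturedConfiguration.

(** * Orbit spaces and open quotient maps *)

Section Orbits.
Variables (X : topologicalType) (n : nat) (G : {group 'S_n}).
Implicit Types x y : configuration X n.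

Definition orbit_of x : orbit_configuration X G :=
  \pi_{eq_quot (same_orbit_equiv X G)} x.

Definition orbit_repr (q : orbit_configuration X G) : configuration X n :=
  repr (q : {eq_quot (same_orbit_equiv X G)}).

Lemma orbit_reprK : cancel orbit_repr orbit_of.
Proof. exact: reprK. Qed.

Lemma orbit_ofP x y : orbit_of x = orbit_of y <->
  exists2 s : 'S_n, s \in G & forall i, point_of y i = point_of x (s i).
Proof.
split=> [/eqmodP/asboolP//|h].
by apply/eqmodP/asboolP.
Qed.

Lemma orbit_of_continuous : continuous orbit_of.
Proof. exact: (@pi_continuous _ {eq_quot (same_orbit_equiv X G)}). Qed.

Lemma orbit_fun_continuous (Z : topologicalType)
    (f : orbit_configuration X G -> Z) :
  continuous (fun x => f (orbit_of x)) -> continuous f.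
Proof. by move=> cf; apply/quotient_continuous. Qed.

(** Permutations act by homeomorphisms: if [y] lies in the orbit of a point of [A], the inverse
    permutation carries a whole neighbourhood of [y] into [A]. *)
Lemma orbit_of_open (A : set (configuration X n)) :
  open A -> open (orbit_of @` A).
Proof.
move=> oA; rewrite -[open _]/(open (orbit_of @^-1` (orbit_of @` A))).
rewrite openE => y [x Ax /orbit_ofP[s sG yx]].
have pI (z : configuration X n) : injective (fun i => point_of z ((s^-1)%g i)).
  by move=> i j ij; apply: (@perm_inj _ (s^-1)%g); apply: configurationP ij.
pose g (z : configuration X n) := Configuration (pI z).
have cg : continuous g.
  by apply: configuration_continuous => i; exact: point_of_continuous.
have gy : g y = x.
  by apply: configuration_eq => i; rewrite -[LHS]/(point_of y _) yx permKV.
have : nbhs y (g @^-1` A) by apply: cg; apply: open_nbhs_nbhs; rewrite gy.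
apply: filterS => z Az; exists (g z) => //; apply/orbit_ofP; exists s => // i.
by rewrite -[RHS]/(point_of z _) permK.
Qed.

End Orbits.

(** Openness is tested on boxes. The second side of a box is only a neighbourhood, so [f] is applied
    to its interior. *)
Lemma open_map_setX (A B C : topologicalType) (f : B -> C) (D : set (A * B)) :
  (forall W, open W -> open (f @` W)) -> open D ->
  open ((fun z => (z.1, f z.2)) @` D).
Proof.
move=> fo oD; rewrite openE => _ [[a b] Dab <-].
have [[V W] [/= Va Wb] VW] : nbhs (a, b) D by exact: open_nbhs_nbhs.
exists (V, f @` W°) => /=.
  split => //; apply: open_nbhs_nbhs; split; first exact/fo/open_interior.
  by exists b.
move=> [a' _] [/= Va' [b' Wb' <-]]; exists (a', b') => //; apply: VW; split => //.
exact: interior_subset.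
Qed.

(** * Translations of the torus *)

Section TorusShift.
Variables (R : realType) (o : torus R).
Local Notation T := (torus R).

Definition tmul (a b : T) : T := (cmul a.1 b.1, cmul a.2 b.2).
Definition tinv (a : T) : T := (cinv a.1, cinv a.2).

(* a - b + o, in additive notation *)
Definition shift (a b : T) : T := tmul a (tmul (tinv b) o).
(** This is a - o + b, the inverse of [shift] in its first argument for fixed [b]. *)
Definition unshift (a b : T) : T := tmul a (tmul (tinv o) b).

Lemma circle_shiftK (a b c : circle R) :
  cmul (cmul a (cmul (cinv b) c)) (cmul (cinv c) b) = a.
Proof. by rewrite -!cmulA cmulVK cmulV cmulC cmul1. Qed.

Lemma shiftK (a b : T) : unshift (shift a b) b = a.
Proof. by rewrite /unshift /shift /tmul /= !circle_shiftK -surjective_pairing. Qed.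

Lemma unshiftK (a b : T) : shift (unshift a b) b = a.
Proof. by rewrite /unshift /shift /tmul /= !circle_shiftK -surjective_pairing. Qed.

Lemma unshift_base (b : T) : unshift o b = b.
Proof. by rewrite /unshift /tmul /= !cmulVK -surjective_pairing. Qed.

Lemma shift_diag (b : T) : shift b b = o.
Proof. by rewrite -{1}(unshift_base b) unshiftK. Qed.

Lemma tmul_continuous (Z : topologicalType) (f g : Z -> T) :
  continuous f -> continuous g -> continuous (fun z => tmul (f z) (g z)).
Proof.
move=> cf cg; apply: pair_continuous; apply: cmul_continuous.
- by apply: comp_continuous cf; exact: fst_continuous.
- by apply: comp_continuous cg; exact: fst_continuous.
- by apply: comp_continuous cf; exact: snd_continuous.
- by apply: comp_continuous cg; exact: snd_continuous.
Qed.

Lemma tinv_continuous : continuous tinv.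
Proof.
apply: pair_continuous; apply: comp_continuous; try exact: cinv_continuous.
- exact: fst_continuous.
- exact: snd_continuous.
Qed.

Lemma shift_continuous (Z : topologicalType) (f g : Z -> T) :
  continuous f -> continuous g -> continuous (fun z => shift (f z) (g z)).
Proof.
move=> cf cg; apply: tmul_continuous => //; apply: tmul_continuous.
  by apply: comp_continuous cg; exact: tinv_continuous.
exact: cst_continuous.
Qed.

Lemma unshift_continuous (Z : topologicalType) (f g : Z -> T) :
  continuous f -> continuous g -> continuous (fun z => unshift (f z) (g z)).
Proof.
move=> cf cg; apply: tmul_continuous => //; apply: tmul_continuous => //.
exact: cst_continuous.
Qed.

End TorusShift.

(** * The equivariant homeomorphism and its descent to orbit spaces *)

Section Splitting.
Variables (R : realType) (n : nat) (H : {group 'S_n}) (G : {group 'S_n.+1}).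
Hypothesis GE : (G : {set 'S_n.+1}) = times_one H.
Variable o : torus R.
Local Notation T := (torus R).
Local Notation X := (punctured_torus o).

Definition last_point (x : configuration T n.+1) : T := point_of x ord_max.

(** Only the last point itself is translated to the puncture, and the points of a configuration are
    distinct. *)
Fact others_neq (x : configuration T n.+1) (i : 'I_n) :
  shift o (point_of x (lift ord_max i)) (last_point x) != o.
Proof.
apply/eqP => h; have := shiftK o (point_of x (lift ord_max i)) (last_point x).
rewrite h unshift_base => /configurationP/eqP.
by rewrite (negPf (neq_lift _ _)).
Qed.

Fact others_inj (x : configuration T n.+1) :
  injective (fun i => puncture (others_neq x i)).
Proof.
move=> i j /(congr1 set_val) /= /(congr1 (fun a => unshift o a (last_point x))).
by rewrite !shiftK => /configurationP /lift_inj.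
Qed.

Definition others (x : configuration T n.+1) : configuration X n :=
  Configuration (@others_inj x).

Definition insert_fun (z : T * configuration X n) (j : 'I_n.+1) : T :=
  if unlift ord_max j is Some i then unshift o (tpoint z.2 i) z.1 else z.1.

Lemma insert_fun_last z : insert_fun z ord_max = z.1.
Proof. by rewrite /insert_fun unlift_none. Qed.

Lemma insert_fun_lift z i :
  insert_fun z (lift ord_max i) = unshift o (tpoint z.2 i) z.1.
Proof. by rewrite /insert_fun liftK. Qed.

Fact insert_inj z : injective (insert_fun z).
Proof.
have shiftE i := unshiftK o (tpoint z.2 i) z.1.
move=> j k; case: (unliftP ord_max j) => [i|] ->;
  case: (unliftP ord_max k) => [l|] ->; rewrite ?insert_fun_last ?insert_fun_lift //.
- by move=> e; have := shiftE i; rewrite e shiftE => /tpoint_inj ->.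
- by move=> e; have := shiftE i; rewrite e shift_diag => /esym/eqP;
    rewrite (negPf (tpoint_neq _ _)).
- by move=> e; have := shiftE l; rewrite -e shift_diag => /esym/eqP;
    rewrite (negPf (tpoint_neq _ _)).
Qed.

Definition insert (z : T * configuration X n) : configuration T n.+1 :=
  Configuration (@insert_inj z).

Lemma point_of_insert z j : point_of (insert z) j = insert_fun z j.
Proof. by []. Qed.

Lemma tpoint_others x i :
  tpoint (others x) i = shift o (point_of x (lift ord_max i)) (last_point x).
Proof. by []. Qed.

Lemma others_continuous : continuous others.
Proof.
apply: configuration_continuous => i; apply: subtype_continuous.
by apply: shift_continuous; exact: point_of_continuous.
Qed.

Lemma tpoint_continuous i : continuous (fun y : configuration X n => tpoint y i).
Proof.
apply: (comp_continuous (f := set_val)); first exact: initial_continuous.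
exact: point_of_continuous.
Qed.

Lemma insert_continuous : continuous insert.
Proof.
apply: configuration_continuous => j.
rewrite (_ : (fun z => _) = insert_fun ^~ j)// /insert_fun.
case: unlift => [i|]; last exact: fst_continuous.
apply: unshift_continuous; last exact: fst_continuous.
apply: (comp_continuous (f := fun y : configuration X n => tpoint y i));
  last exact: snd_continuous.
exact: tpoint_continuous.
Qed.

Lemma last_insert z : last_point (insert z) = z.1.
Proof. exact: insert_fun_last. Qed.

Lemma others_insert z : others (insert z) = z.2.
Proof.
apply: configuration_eq => i; apply: val_inj.
rewrite -[LHS]/(tpoint _ i) tpoint_others last_insert point_of_insert.
by rewrite insert_fun_lift unshiftK.
Qed.

Lemma insert_others x : insert (last_point x, others x) = x.
Proof.
apply: configuration_eq => j; rewrite point_of_insert.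
case: (unliftP ord_max j) => [i|] ->; rewrite ?insert_fun_last//.
by rewrite insert_fun_lift tpoint_others shiftK.
Qed.

(** The factor {1} of G enters here: its elements fix [ord_max]. *)
Lemma last_orbit x y : orbit_of G x = orbit_of G y -> last_point x = last_point y.
Proof.
move=> /orbit_ofP[s]; rewrite GE => /imsetP[t _ ->] yx.
by rewrite /last_point yx lift_perm_id.
Qed.

(** Equal last points mean that both configurations are translated by the same amount; what remains
    of a permutation in G is its component in H. *)
Lemma others_orbit x y : orbit_of G x = orbit_of G y ->
  orbit_of H (others x) = orbit_of H (others y).
Proof.
move=> xy; have lxy := last_orbit xy; have /orbit_ofP[s] := xy.
rewrite GE => /imsetP[t tH ->] yx; apply/orbit_ofP; exists t => // i.
apply: val_inj; rewrite -[LHS]/(tpoint _ i) -[RHS]/(tpoint _ (t i)).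
by rewrite !tpoint_others yx lift_perm_lift lxy.
Qed.

Lemma insert_orbit a x y : orbit_of H x = orbit_of H y ->
  orbit_of G (insert (a, x)) = orbit_of G (insert (a, y)).
Proof.
move=> /orbit_ofP[s sH yx]; apply/orbit_ofP.
exists (lift_perm ord_max ord_max s) => [|j]; first by rewrite GE imset_f.
rewrite !point_of_insert; case: (unliftP ord_max j) => [i|] ->.
  by rewrite lift_perm_lift !insert_fun_lift /= /tpoint yx.
by rewrite lift_perm_id !insert_fun_last.
Qed.

(** Computed on a chosen representative; [split_orbitE] removes the choice, and continuity is then
    checked before passing to the quotient. *)
Definition split_orbit (q : orbit_configuration T G) :
    T * orbit_configuration X H :=
  (last_point (orbit_repr q), orbit_of H (others (orbit_repr q))).

Definition glue_orbit (z : T * orbit_configuration X H) :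
    orbit_configuration T G :=
  orbit_of G (insert (z.1, orbit_repr z.2)).

Lemma split_orbitE x :
  split_orbit (orbit_of G x) = (last_point x, orbit_of H (others x)).
Proof.
have h := orbit_reprK (orbit_of G x).
by congr (_, _); [exact: last_orbit|exact: others_orbit].
Qed.

Lemma glue_orbitE a y : glue_orbit (a, orbit_of H y) = orbit_of G (insert (a, y)).
Proof. by apply: insert_orbit; exact: orbit_reprK. Qed.

Lemma split_orbitK : cancel split_orbit glue_orbit.
Proof.
move=> q; rewrite -(orbit_reprK q) split_orbitE glue_orbitE.
by rewrite insert_others.
Qed.

Lemma glue_orbitK : cancel glue_orbit split_orbit.
Proof.
move=> [a q]; rewrite -(orbit_reprK q) glue_orbitE split_orbitE.
by rewrite last_insert others_insert.
Qed.

Lemma split_orbit_continuous : continuous split_orbit.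
Proof.
apply: orbit_fun_continuous.
rewrite (_ : (fun x => _) = (fun x => (last_point x, orbit_of H (others x)))).
  apply: pair_continuous; first exact: point_of_continuous.
  apply: comp_continuous; [exact: orbit_of_continuous|exact: others_continuous].
by apply/funext => x; exact: split_orbitE.
Qed.

(* The quotient map stays open, hence a quotient map, after taking the
   product with T. *)
Lemma glue_orbit_continuous : continuous glue_orbit.
Proof.
apply/continuousP => A oA.
rewrite (_ : _ @^-1` _ = (fun z => (z.1, orbit_of H z.2)) @`
    ((fun z => orbit_of G (insert z)) @^-1` A)).
  apply: open_map_setX; first exact: orbit_of_open.
  apply: (@open_comp _ _ (fun z => orbit_of G (insert z)) A) => // z _.
  apply: (@comp_continuous _ _ _ (@orbit_of _ _ G) insert).
    exact: orbit_of_continuous.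
  exact: insert_continuous.
apply/seteqP; split => [[a q] Aaq|_ [[a y] Aay <-]] /=; last by rewrite glue_orbitE.
by exists (a, orbit_repr q) => //=; rewrite orbit_reprK.
Qed.

End Splitting.

(** * Assembling the isomorphism *)

Lemma orbit_configuration_path (R : realType) (X : topologicalType) (n : nat)
    (H : {group 'S_n}) (x y : orbit_configuration X H) :
  (forall x y : configuration X n, joined_in R setT x y) ->
  exists p : {path unit_interval R from x to y in orbit_configuration X H}, True.
Proof.
move=> join; have [p _ _] := join (orbit_repr x) (orbit_repr y).
have := path_image (@orbit_of_continuous X n H) p.
by rewrite !orbit_reprK => q; exists q.
Qed.

(** Here [n] is the number of symbols on which H acts, so configurations on the torus have n + 1
    points and at least one point is always present. A multiplicative bijection is a group
    isomorphism, with Z^2 written additively. *)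
Theorem theorem3p11 (R : realType) (n : nat)
    (H : {group 'S_n}) (G : {group 'S_n.+1})
    (GE : (G : {set 'S_n.+1}) = times_one H)
    (o : torus R)
    (x : orbit_configuration (torus R) G)
    (y : orbit_configuration (punctured_torus o) H) :
  exists2 f : pi1 R x -> pi1 R y * (int * int),
    bijective f &
    forall a b : pi1 R x,
      f (a * b)%g = (((f a).1 * (f b).1)%g, (f a).2 + (f b).2).
Proof.
pose z := split_orbit H o x.
have cs := @split_orbit_continuous R n H G GE o.
(* The base point [z.2] is imposed by [x]; conjugation by [c] carries it to the given [y]. *)
have [c _] := orbit_configuration_path z.2 y (@configuration_joined R o n).
have [d1 d1B d1M] := pi1_circle z.1.1.
have [d2 d2B d2M] := pi1_circle z.1.2.
(* [e] separates T from the orbit space, and [t] then separates the two circles of T. *)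
pose e (a : pi1 R x) := pi1_pair (pi1_map cs a).
pose t a := pi1_pair (e a).1.
exists (fun a => (pi1_conj c (e a).2, (d1 (t a).1, d2 (t a).2))).
  have [m mK Km] := pi1_map_bij R cs x (@glue_orbit_continuous R n H G GE o)
    (@split_orbitK R n H G GE o) (@glue_orbitK R n H G GE o).
  have [u uK Ku] := pi1_pair_bij R z.
  have [v vK Kv] := pi1_pair_bij R z.1.
  have [k kK Kk] := pi1_conj_bij c.
  have [g1 g1K Kg1] := d1B; have [g2 g2K Kg2] := d2B.
  have eE b : e (m (u b)) = b by rewrite /e Km; exact: Ku.
  have tE b b' : t (m (u (v b, b'))) = b by rewrite /t eE; exact: Kv.
  exists (fun w => m (u (v (g1 w.2.1, g2 w.2.2), k w.1))) => [a|[w1 [w2 w3]]].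
    rewrite /= g1K g2K kK -[((t a).1, (t a).2)]surjective_pairing vK.
    by rewrite -surjective_pairing uK mK.
  cbv beta; rewrite [w in m w]/=; set q := m _.
  have tq : t q = (g1 w2, g2 w3) by exact: tE.
  have eq : e q = (v (g1 w2, g2 w3), k w1) by exact: eE.
  by rewrite tq eq /= Kk Kg1 Kg2.
move=> a b; cbv beta.
have eM : e (a * b)%g = ((e a).1 * (e b).1, (e a).2 * (e b).2)%g.
  by rewrite /e pi1_mapM /pi1_pair !pi1_mapM.
have tM : t (a * b)%g = ((t a).1 * (t b).1, (t a).2 * (t b).2)%g.
  by rewrite /t eM /pi1_pair !pi1_mapM.
by rewrite tM eM /= d1M d2M pi1_conjM.
Qed.
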